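(* Fix a field $K$. The class $\mathcal M_{QG}$ of matroids whose toric ideal has a Gr\''obner basis (with respect to some monomial order) consisting of quadratic binomials, and the class $\mathcal M_Q$ of matroids whose toric ideal is generated by quadratic binomials, are each closed under series connections, parallel connections and 2-sums: if $M_1$ and $M_2$ are matroids in the class with $E_1\cap E_2=\{c\}$, then $S(M_1,M_2)$ and $P(M_1,M_2)$ belong to the class, and, when $c$ is neither a loop nor a coloop of $M_1$ or of $M_2$, so does $M_1\oplus_2M_2$.
   Context: For a matroid $M$ on $E$ with bases $B_1,\dots,B_n$, the toric ideal is $J_M=\ker\big(K[x_1,\dots,x_n]\to K[s_e:e\in E],\ x_j\mapsto\prod_{e\in B_j}s_e\big)$. A loop is an element in no basis; a coloop is an element in every basis. Deletion $M\setminus c$: the matroid on $E\setminus\{c\}$ with bases $\{B\setminus\{c\}\}$ if $c$ is a coloop, and $\{B: c\notin B\}$ otherwise; dual $M^*$ has bases $E\setminus B$; contraction $M/c=(M^*\setminus c)^*$. Direct sum $M_1\oplus M_2$ (disjoint ground sets) has bases $B\cup D$. Let $M_1$, $M_2$ be matroids on $E_1,E_2$ with $E_1\cap E_2=\{c\}$. If $c$ is neither a loop nor a coloop of $M_1$ and of $M_2$: the series connection $S(M_1,M_2)$ is the matroid on $E_1\cup E_2$ with bases $\{B\cup D: B\in\mathcal B(M_1),D\in\mathcal B(M_2),B\cap D=\emptyset\}$, and the parallel connection $P(M_1,M_2)$ has bases $\{B\cup D: c\in B\cap D\}\cup\{(B\cup D)\setminus\{c\}: c \text{ lies in exactly one of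 } B,D\}$. If $c$ is a loop of $M_1$: $P(M_1,M_2)=M_1\oplus(M_2/c)$, $S(M_1,M_2)=(M_1/c)\oplus M_2$. If $c$ is a coloop of $M_1$: $P(M_1,M_2)=(M_1\setminus c)\oplus M_2$, $S(M_1,M_2)=M_1\oplus(M_2\setminus c)$; symmetrically with the roles of $M_1,M_2$ exchanged when $c$ is a loop or coloop of $M_2$. The 2-sum is $M_1\oplus_2M_2=S(M_1,M_2)/c=P(M_1,M_2)\setminus c$, defined when $c$ is neither a loop nor a coloop of $M_1$ or $M_2$. *)

(* Defs.v *)
From mathcomp Require Import all_boot all_order all_algebra.
From mathcomp Require Import mpoly.

Set Implicit Arguments.
Unset Strict Implicit.
Unset Printing Implicit Defensive.

Import GRing.Theory.
Local Open Scope ring_scope.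

(* All ground sets are subsets of one finite type T of possible elements, so
   that [:|:] and [:&:] of the ground sets of two matroids make sense. The
   operations below are total on arbitrary families of sets; [is_matroid] is
   part of the classes MQG and MQ, hence of the claim that they are closed. *)
Record basis_system (T : finType) := BasisSystem {
  ground : {set T};
  bases : {set {set T}}
}.

Section Matroids.
Variable T : finType.
Implicit Types (M N : basis_system T) (c : T).

Definition is_matroid M : Prop :=
  [/\ bases M != set0,
      forall B, B \in bases M -> B \subset ground M
    & forall B D, B \in bases M -> D \in bases M ->
        forall x, x \in B :\: D ->
          exists2 y, y \in D :\: B & y |: (B :\ x) \in bases M].

Definition loop M c : bool :=
  (c \in ground M) && [forall B in bases M, c \notin B].

Definition coloop M c : bool :=
  (c \in ground M) && [forall B in bases M, c \in B].

Definition deletion M c : basis_system T :=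
  BasisSystem (ground M :\ c)
    (if coloop M c then [set B :\ c | B in bases M]
     else [set B in bases M | c \notin B]).

Definition dual M : basis_system T :=
  BasisSystem (ground M) [set ground M :\: B | B in bases M].

Definition contraction M c : basis_system T := dual (deletion (dual M) c).

Definition direct_sum M N : basis_system T :=
  BasisSystem (ground M :|: ground N)
    [set B :|: D | B in bases M, D in bases N].

(* In [series] and [parallel], when c is a loop or coloop of both arguments,
   several branches apply; they define the same matroid, so that the order of
   the tests is immaterial. *)
Definition series M1 M2 c : basis_system T :=
  if loop M1 c then direct_sum (contraction M1 c) M2
  else if coloop M1 c then direct_sum M1 (deletion M2 c)
  else if loop M2 c then direct_sum M1 (contraction M2 c)
  else if coloop M2 c then direct_sum (deletion M1 c) M2
  else BasisSystem (ground M1 :|: ground M2)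
         [set B :|: D | B in bases M1, D in bases M2 & B :&: D == set0].

Definition parallel M1 M2 c : basis_system T :=
  if loop M1 c then direct_sum M1 (contraction M2 c)
  else if coloop M1 c then direct_sum (deletion M1 c) M2
  else if loop M2 c then direct_sum (contraction M1 c) M2
  else if coloop M2 c then direct_sum M1 (deletion M2 c)
  else BasisSystem (ground M1 :|: ground M2)
         ([set B :|: D | B in bases M1, D in bases M2 & c \in B :&: D]
          :|: [set (B :|: D) :\ c
                | B in bases M1, D in bases M2 & (c \in B) (+) (c \in D)]).

Definition two_sum M1 M2 c : basis_system T := contraction (series M1 M2 c) c.

End Matroids.

Definition ideal_span (R : comNzRingType) (S : R -> Prop) (p : R) : Prop :=
  exists k (a g : 'I_k -> R),
    (forall i, S (g i)) /\ p = \sum_(i < k) a i * g i.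

Section Groebner.
Variables (K : fieldType) (n : nat).
Implicit Types (le : rel 'X_{1..n}) (p q : {mpoly K[n]}).

Definition monomial_order le : Prop :=
  [/\ reflexive le, antisymmetric le, transitive le, total le
    & (forall m, le 0%MM m) /\
      (forall m m1 m2, le m1 m2 -> le (m + m1)%MM (m + m2)%MM)].

(* No monomial is a leading monomial of 0. *)
Definition is_lead_monom le p (m : 'X_{1..n}) : Prop :=
  m \in msupp p /\ forall m', m' \in msupp p -> le m' m.

Definition initial_ideal le (S : {mpoly K[n]} -> Prop) : {mpoly K[n]} -> Prop :=
  ideal_span (fun q => exists p m,
    [/\ S p, is_lead_monom le p m & q = 'X_[m]]).

Definition groebner_basis le (I : {mpoly K[n]} -> Prop)
    (G : seq {mpoly K[n]}) : Prop :=
  (forall g, g \in G -> I g) /\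
  (forall q, initial_ideal le I q <-> initial_ideal le (fun g => g \in G) q).

Definition quadratic_binomial p : Prop :=
  exists u v : 'X_{1..n},
    [/\ u != v, mdeg u = 2%N, mdeg v = 2%N & p = 'X_[u] - 'X_[v]].

End Groebner.

Section ToricIdeal.
Variables (K : fieldType) (T : finType) (M : basis_system T).

(* The variable x_j (resp. s_i) belongs to the j-th set in [enum (bases M)]
   (resp. the i-th element in [enum (ground M)]). *)
Definition toric_map (p : {mpoly K[#|bases M|]}) : {mpoly K[#|ground M|]} :=
  p \mPo [tuple \prod_(i < #|ground M| | enum_val i \in enum_val j) 'X_i
           | j < #|bases M|].

Definition toric_ideal (p : {mpoly K[#|bases M|]}) : Prop := toric_map p = 0.

Definition MQG : Prop :=
  is_matroid M /\
  exists le : rel 'X_{1..#|bases M|}, exists G : seq {mpoly K[#|bases M|]},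
    [/\ monomial_order le,
        groebner_basis le toric_ideal G
      & forall g, g \in G -> quadratic_binomial g].

Definition MQ : Prop :=
  is_matroid M /\
  exists G : seq {mpoly K[#|bases M|]},
    (forall p, toric_ideal p <-> ideal_span (fun g => g \in G) p) /\
    (forall g, g \in G -> quadratic_binomial g).

End ToricIdeal.

(* Main.v *)
Require Import Defs.
From mathcomp Require Import all_boot all_order all_algebra.
From mathcomp Require Import mpoly.
From mathcomp Require Import zify.
From Stdlib Require Import ClassicalEpsilon.

(** Toric ideals are spanned by binomials, so both classes can be described by
    the fibers of the monomial parametrization. A matroid of positive rank is
    in MQ iff the monomials of each fiber are connected by quadratic moves, and
    in MQG iff, for some monomial order, every monomial that is not minimal in
    its fiber has a quadratic divisor that is not minimal in its own fiber (in
    rank 0 the ideal is generated by [x - 1], so rank 0 has to be excluded all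
    along). Both properties pass to faces of the monoid of monomials, hence to
    minors and duals.

    If the ground sets of M1 and M2 meet in at most c, the disjoint unions of a
    basis of M1 and a basis of M2 are the cells of an array whose rows and
    columns are the bases of M1 and of M2; when these are sorted by membership
    of c, the allowed cells form a staircase. Two monomials are in the same
    fiber iff their row marginals are, and their column marginals are. A quadratic
    move on the rows or on the columns preserves membership of c, so it lifts
    to the array; monomials with the same marginals are related by exchanging
    the two diagonals of 2 x 2 minors, and in a staircase this can be done so
    as to decrease the row-major lexicographic order. Direct sums and series
    connections are of this form, parallel connections are dual to series
    connections, and the 2-sum is a contraction of the series connection. *)

Set Implicit Arguments.
Unset Strict Implicit.
Unset Printing Implicit Defensive.

Import GRing.Theory.

(** * Monomials, fibers and faces *)

Section Monomials.
Variable n : nat.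
Implicit Types (u v w : 'X_{1..n}) (i j : 'I_n).

Lemma mnm_addKl w u v : (w + u = w + v)%MM -> u = v.
Proof.
by move/mnmP=> E; apply/mnmP=> i; have := E i; rewrite !mnmDE => /addnI.
Qed.

Lemma mnm_pick u i : 0 < u i -> exists w, u = (U_(i) + w)%MM.
Proof.
move=> ui; exists (u - U_(i))%MM; apply/mnmP=> j.
by rewrite mnmDE mnmBE mnm1E; case: eqP => [<-|_] //=; lia.
Qed.

Lemma mdeg_gt0_pick u : 0 < mdeg u -> exists i w, u = (U_(i) + w)%MM.
Proof.
move=> du; case: (pickP (fun i => 0 < u i)) => [i /mnm_pick [w ->]|u0].
  by exists i, w.
by move: du; rewrite mdegE big1 // => i _; have := u0 i; case: (u i).
Qed.

Lemma mdeg2P u : mdeg u = 2 -> exists i j, u = (U_(i) + U_(j))%MM.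
Proof.
move=> du; have [|i [w uE]] := @mdeg_gt0_pick u; first by rewrite du.
have /eqP/mdeg1P[j /eqP wE] : mdeg w = 1.
  by move: du; rewrite uE mdegD mdeg1 => -[].
by exists i, j; rewrite uE wE.
Qed.

End Monomials.

Section Push.
Variables (m n : nat) (f : 'I_m -> 'I_n).
Implicit Types (u v w : 'X_{1..m}).

Definition push u : 'X_{1..n} := [multinom \sum_(i < m | f i == j) u i | j < n].

Lemma pushE u j : push u j = \sum_(i < m | f i == j) u i.
Proof. exact: mnmE. Qed.

Lemma pushD u v : push (u + v)%MM = (push u + push v)%MM.
Proof.
apply/mnmP=> j; rewrite mnmDE !pushE -big_split /=.
by apply: eq_bigr => i _; rewrite mnmDE.
Qed.

Lemma push0 : push 0%MM = 0%MM.
Proof. by apply/mnmP=> j; rewrite pushE mnm0E big1 // => i _; rewrite mnm0E. Qed.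

Lemma push1 i : push U_(i) = U_(f i)%MM.
Proof.
apply/mnmP=> j; rewrite pushE mnm1E big_mkcond (bigD1 i) //= mnm1E eqxx.
rewrite big1 ?addn0 => [|k /negbTE ki]; first by case: eqP.
by rewrite mnm1E (eq_sym i) ki if_same.
Qed.

Lemma sum_push (w : 'I_n -> nat) u :
  \sum_(j < n) push u j * w j = \sum_(i < m) u i * w (f i).
Proof.
under eq_bigr do rewrite pushE big_distrl /=.
rewrite (exchange_big_dep predT) //=; apply: eq_bigr => i _.
by rewrite (big_pred1 (f i)) // => j; rewrite eq_sym.
Qed.

Lemma mdeg_push u : mdeg (push u) = mdeg u.
Proof.
rewrite !mdegE; have := sum_push (fun=> 1) u.
by rewrite -!big_distrl /= !muln1.
Qed.

Lemma push_pick u (j : 'I_n) (w : 'X_{1..n}) : push u = (U_(j) + w)%MM ->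
  exists i u', [/\ u = (U_(i) + u')%MM, f i = j & push u' = w].
Proof.
move=> E; have : 0 < push u j by rewrite E mnmDE mnm1E eqxx.
rewrite pushE => pos.
have [i fi ui] : exists2 i, f i = j & 0 < u i.
  case: (pickP (fun i => (f i == j) && (0 < u i))) => [i /andP[/eqP fi ui]|no].
    by exists i.
  move: pos; rewrite big1 // => i fi.
  by have := no i; rewrite fi /=; case: (u i).
have [u' uE] := mnm_pick ui; exists i, u'; split => //.
by apply: (@mnm_addKl _ (U_(j))%MM); rewrite -E uE pushD push1 fi.
Qed.

Hypothesis f_inj : injective f.

Lemma push_inj_app u i : push u (f i) = u i.
Proof.
rewrite pushE (big_pred1 i) // => k; apply/eqP/eqP=> [/f_inj //|-> //].
Qed.

Lemma push_inj : injective push.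
Proof.
by move=> u v E; apply/mnmP=> i; rewrite -!push_inj_app E.
Qed.

Lemma push_codom u j : push u j != 0 -> j \in codom f.
Proof.
rewrite pushE => nz; case: (pickP (fun i => f i == j)) => [i /eqP <-|no].
  exact: codom_f.
by move: nz; rewrite big_pred0.
Qed.

Lemma pushP (v : 'X_{1..n}) :
  (forall j, v j != 0 -> j \in codom f) -> exists u, v = push u.
Proof.
move=> supp; exists [multinom v (f i) | i < m]; apply/mnmP=> j.
have [/codomP[i ->]|jf] := boolP (j \in codom f).
  by rewrite push_inj_app mnmE.
have -> : v j = 0 by apply/eqP; apply: contraNT jf => /supp.
rewrite pushE big_pred0 // => i; apply: contraNF jf => /eqP <-.
exact: codom_f.
Qed.

End Push.

Section Fibers.
Variables (T : finType) (n : nat) (b : 'I_n -> {set T}).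
Implicit Types (u v w p q : 'X_{1..n}).

Definition inc u (e : T) : nat := \sum_(i < n) u i * (e \in b i).

(* [fib u v] says that 'X_[u] - 'X_[v] lies in the homogeneous part of the
   toric ideal; the condition on degrees matters only if some [b i] is empty. *)
Definition fib u v : bool :=
  (mdeg u == mdeg v) && [forall e, inc u e == inc v e].

Lemma fibP u v :
  reflect (mdeg u = mdeg v /\ forall e, inc u e = inc v e) (fib u v).
Proof.
apply: (iffP andP) => [[/eqP-> /forallP h]|[-> h]]; split=> //.
  by move=> e; apply/eqP.
by apply/forallP=> e; apply/eqP.
Qed.

Lemma incD u v e : inc (u + v)%MM e = inc u e + inc v e.
Proof.
by rewrite /inc -big_split; apply: eq_bigr => i _; rewrite mnmDE mulnDl.
Qed.

Lemma inc1 i e : inc U_(i)%MM e = (e \in b i).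
Proof.
rewrite /inc (bigD1 i) //= mnm1E eqxx mul1n big1 ?addn0 // => k ki.
by rewrite mnm1E (eq_sym i) (negbTE ki).
Qed.

Lemma fib_refl u : fib u u.
Proof. exact/fibP. Qed.

Lemma fib_sym u v : fib u v = fib v u.
Proof. by apply/fibP/fibP => -[-> h]; split. Qed.

Lemma fibDr w u v : fib (u + w)%MM (v + w)%MM = fib u v.
Proof.
apply/fibP/fibP=> -[d h]; split=> [|e].
- by move/eqP: d; rewrite !mdegD eqn_add2r => /eqP.
- by have /eqP := h e; rewrite !incD eqn_add2r => /eqP.
- by rewrite !mdegD d.
- by rewrite !incD h.
Qed.

Definition quad_groebner : Prop :=
  exists2 le : rel 'X_{1..n}, monomial_order le &
    forall u v, fib u v -> le v u -> v != u ->
      exists p q w, [/\ u = (p + w)%MM, mdeg p = 2, fib p q, le q p & q != p].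

Inductive conn u : 'X_{1..n} -> Prop :=
| conn_refl : conn u u
| conn_step v p q w : v = (p + w)%MM -> mdeg p = 2 -> fib p q ->
    conn u v -> conn u (q + w)%MM.

Lemma conn_trans u v w : conn u v -> conn v w -> conn u w.
Proof.
move=> uv; elim=> // w' p q r -> dp pq _ uw.
exact: (conn_step (erefl _) dp pq uw).
Qed.

Lemma conn_sym u v : conn u v -> conn v u.
Proof.
elim=> [|v' p q w -> dp pq _ IH]; first exact: conn_refl.
have dq : mdeg q = 2 by case/fibP: pq => <-.
rewrite fib_sym in pq.
exact: conn_trans (conn_step (erefl _) dq pq (conn_refl _)) IH.
Qed.

Definition quad_connected : Prop := forall u v, fib u v -> conn u v.

End Fibers.

Lemma inc_push (T : finType) m n (b : 'I_n -> {set T}) (f : 'I_m -> 'I_n) u e :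
  inc b (push f u) e = inc (b \o f) u e.
Proof. exact: (sum_push f (fun j => e \in b j : nat)). Qed.

(* [f] identifies the monomials in m variables with a face of the monoid of
   monomials in n variables, that is, with a union of fibers. *)
Definition face_map (T : finType) m n (b' : 'I_m -> {set T})
    (b : 'I_n -> {set T}) (f : 'I_m -> 'I_n) : Prop :=
  [/\ injective f,
      forall u v, fib b' u v = fib b (push f u) (push f v)
    & forall u v, fib b (push f u) v -> forall i, v i != 0 -> i \in codom f].

Section Face.
Variables (T : finType) (m n : nat).
Variables (b' : 'I_m -> {set T}) (b : 'I_n -> {set T}) (f : 'I_m -> 'I_n).
Hypothesis fF : face_map b' b f.

Let f_inj : injective f. Proof. by case: fF. Qed.

Lemma face_factor u p q w : push f u = (p + w)%MM -> fib b p q ->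
  exists p' q' w', [/\ u = (p' + w')%MM, p = push f p', q = push f q',
    w = push f w' & fib b' p' q'].
Proof.
case: fF => _ Hfib Hface E pq.
have h : fib b (push f u) (q + w)%MM by rewrite E fibDr.
have {}h := Hface _ _ h.
have [q' qE] : exists q', q = push f q'.
  by apply: pushP => // j qj; apply: h; rewrite mnmDE addn_eq0 negb_and qj.
have [w' wE] : exists w', w = push f w'.
  by apply: pushP => // j wj; apply: h; rewrite mnmDE addn_eq0 negb_and wj orbT.
have [p' pE] : exists p', p = push f p'.
  apply: pushP => // j pj; apply: (@push_codom _ _ f u).
  by rewrite E mnmDE addn_eq0 negb_and pj.
exists p', q', w'; split=> //; last by rewrite Hfib -pE -qE.
by apply: (push_inj f_inj); rewrite pushD -pE -wE.
Qed.

Lemma face_quad_groebner : quad_groebner b -> quad_groebner b'.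
Proof.
case: (fF) => _ Hfib _ [le [lexx le_anti le_tr le_tot [le0 leD]] gb].
exists (fun u v => le (push f u) (push f v)); first split.
- by move=> u.
- by move=> u v /le_anti /(push_inj f_inj).
- by move=> v u w; apply: le_tr.
- by move=> u v; apply: le_tot.
- by split=> [u|w u v uv]; rewrite ?push0 ?pushD; [apply: le0|apply: leD].
move=> u v uv vu nvu.
have [|||p [q [w [E dp pq qp nqp]]]] := gb (push f u) (push f v).
- by rewrite -Hfib.
- exact: vu.
- by apply: contra nvu => /eqP /(push_inj f_inj) ->.
have [p' [q' [w' [uE pE qE wE pq']]]] := face_factor E pq.
exists p', q', w'; split=> //.
- by rewrite -(mdeg_push f) -pE.
- by rewrite -pE -qE.
- by apply: contra nqp => /eqP E'; rewrite pE qE E'.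
Qed.

Lemma face_quad_connected : quad_connected b -> quad_connected b'.
Proof.
case: (fF) => _ Hfib _ cb u v; rewrite Hfib => /cb.
suff lift x : conn b (push f u) x -> forall v', push f v' = x -> conn b' u v'.
  by move/lift; apply.
elim=> [v' /(push_inj f_inj) ->|x' p q w -> dp pq _ IH v' E].
  exact: conn_refl.
have dq : mdeg q = 2 by case/fibP: pq => <-.
rewrite fib_sym in pq.
have [q' [p' [w' [vE qE pE wE pq']]]] := face_factor E pq.
rewrite vE; apply: (@conn_step _ _ _ _ (p' + w')%MM p' q' w') => //.
- by rewrite -(mdeg_push f) -pE.
- by rewrite fib_sym.
- by apply: IH; rewrite pushD -pE -wE.
Qed.

End Face.

(** * Staircases *)

Section LexComp.
Variables (m n : nat) (h : 'X_{1..m} -> 'X_{1..n}).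
Variables (le1 : rel 'X_{1..n}) (le2 : rel 'X_{1..m}).

Definition lexcomp : rel 'X_{1..m} :=
  fun u v => if h u == h v then le2 u v else le1 (h u) (h v).

Lemma lexcomp_monomial_order : h 0%MM = 0%MM ->
  (forall u v, h (u + v)%MM = (h u + h v)%MM) ->
  monomial_order le1 -> monomial_order le2 -> monomial_order lexcomp.
Proof.
move=> h0 hD [le1xx le1_anti le1_tr le1_tot [le10 le1D]].
move=> [le2xx le2_anti le2_tr le2_tot [le20 le2D]].
rewrite /lexcomp; split.
- by move=> u; rewrite eqxx.
- move=> u v; rewrite (eq_sym (h v)); case: eqP => [_ /le2_anti //|ne /le1_anti].
  by move/ne.
- move=> v u w; case: (h u =P h v) => [->|uv]; case: (h v =P h w) => [E|vw] //.
  + exact: le2_tr.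
  + by move=> le_uv _; rewrite -E; move/eqP/negbTE: uv => ->.
  + move=> le_uv le_vw; case: eqP => [E|_]; last exact: le1_tr le_uv le_vw.
    by case: uv; apply: le1_anti; rewrite le_uv E le_vw.
- move=> u v; rewrite (eq_sym (h v)); case: eqP => _.
    exact: le2_tot.
  exact: le1_tot.
- split=> [u|w u v]; first by rewrite h0; case: eqP.
  rewrite !hD; case: (h u =P h v) => [->|ne]; first by rewrite eqxx; apply: le2D.
  by case: eqP => [/mnm_addKl //|_]; apply: le1D.
Qed.

End LexComp.

Section Lex.
Variables (n : nat) (r : 'I_n -> nat).
Hypothesis r_inj : injective r.
Implicit Types u v w : 'X_{1..n}.

Definition lexlt u v : bool :=
  [exists i, (u i < v i) && [forall k, (r k < r i) ==> (u k == v k)]].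

Lemma lexltP u v :
  reflect (exists2 i, u i < v i & forall k, r k < r i -> u k = v k) (lexlt u v).
Proof.
apply: (iffP existsP) => [[i /andP[ui /forallP h]]|[i ui h]]; exists i => //.
  by move=> k ki; apply/eqP; move: (h k); rewrite ki.
by rewrite ui; apply/forallP => k; apply/implyP => /h ->.
Qed.

Lemma lexlt_trans v u w : lexlt u v -> lexlt v w -> lexlt u w.
Proof.
move=> /lexltP[i ui hi] /lexltP[j vj hj]; apply/lexltP.
have [ij|ji|/r_inj ij] := ltngtP (r i) (r j).
- exists i; first by rewrite -hj.
  by move=> k ki; rewrite hi // hj //; apply: ltn_trans ki ij.
- exists j; first by rewrite hi.
  by move=> k kj; rewrite hi ?hj //; apply: ltn_trans kj ji.
- subst j; exists i; first exact: ltn_trans ui vj.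
  by move=> k ki; rewrite hi ?hj.
Qed.

Lemma lexlt_irr u : lexlt u u = false.
Proof. by apply/negbTE/lexltP => -[i]; rewrite ltnn. Qed.

Lemma lexlt_total u v : u != v -> lexlt u v || lexlt v u.
Proof.
move=> ne; have [i0 d0] : exists i, u i != v i.
  apply/existsP; apply: contraNT ne; rewrite negb_exists => /forallP E.
  by apply/eqP/mnmP=> i; apply/eqP; rewrite -[_ == _]negbK.
case: (@arg_minnP _ i0 (fun i => u i != v i) r d0) => i di min_i.
have eq_lt k : r k < r i -> u k = v k.
  by move=> ki; apply: contraTeq ki => /min_i; rewrite -leqNgt.
case: (ltngtP (u i) (v i)) => [lt|lt|E]; last by rewrite E eqxx in di.
  by apply/orP; left; apply/lexltP; exists i.
by apply/orP; right; apply/lexltP; exists i => // k /eq_lt.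
Qed.

Definition lexle : rel 'X_{1..n} := fun u v => (u == v) || lexlt u v.

Lemma lexle_monomial_order : monomial_order lexle.
Proof.
rewrite /lexle; split.
- by move=> u; rewrite eqxx.
- move=> u v; rewrite (eq_sym v); case: eqP => //= _ /andP[uv vu].
  by have := lexlt_trans uv vu; rewrite lexlt_irr.
- move=> v u w /predU1P[-> //|uv] /predU1P[<-|vw]; first by rewrite uv orbT.
  by rewrite (lexlt_trans uv vw) orbT.
- by move=> u v; rewrite (eq_sym v); case: eqP => //= /eqP /lexlt_total.
split=> [u|w u v].
  case: eqP => //= /eqP; rewrite eq_sym => /lexlt_total /orP[/lexltP [i]|//].
  by rewrite mnm0E.
move=> /predU1P[->|/lexltP[i ui h]]; first by rewrite eqxx.
apply/orP; right; apply/lexltP; exists i; first by rewrite !mnmDE ltn_add2l.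
by move=> k /h; rewrite !mnmDE => ->.
Qed.

End Lex.

Section Lift.
Variables (T : finType) (n n1 n2 : nat).
Variables (b1 : 'I_n1 -> {set T}).
Variables (f1 : 'I_n -> 'I_n1) (f2 : 'I_n -> 'I_n2) (t1 : 'I_n1 -> bool).
Hypothesis t1_fib : forall i j k l,
  fib b1 (U_(i) + U_(j))%MM (U_(k) + U_(l))%MM ->
  t1 i = t1 k /\ t1 j = t1 l \/ t1 i = t1 l /\ t1 j = t1 k.
Hypothesis replace1 : forall p i, t1 i = t1 (f1 p) ->
  exists2 q, f1 q = i & f2 q = f2 p.

Lemma lift_quadratic u p w q : push f1 u = (p + w)%MM -> mdeg p = 2 ->
    fib b1 p q ->
  exists p' q' w', [/\ u = (p' + w')%MM, mdeg p' = 2, push f1 p' = p,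
    push f1 q' = q & push f2 q' = push f2 p'].
Proof.
move=> E dp pq; have dq : mdeg q = 2 by case/fibP: pq => <-.
have [i [j pE]] := mdeg2P dp; have [k0 [l0 qE0]] := mdeg2P dq.
have [k [l [qE tk tl]]] : exists k l,
    [/\ q = (U_(k) + U_(l))%MM, t1 k = t1 i & t1 l = t1 j].
  move: pq; rewrite pE qE0 => /t1_fib[[ti tj]|[ti tj]].
    by exists k0, l0.
  by exists l0, k0; split=> //; apply/mnmP => x; rewrite !mnmDE addnC.
have {}E : push f1 u = (U_(i) + (U_(j) + w))%MM.
  by rewrite E pE; apply/mnmP => z; rewrite !mnmDE addnA.
have [x [u1 [uE fx /push_pick[y [w' [u1E fy _]]]]]] := push_pick E.
have [|x' fx' gx'] := @replace1 x k; first by rewrite fx tk.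
have [|y' fy' gy'] := @replace1 y l; first by rewrite fy tl.
exists (U_(x) + U_(y))%MM, (U_(x') + U_(y'))%MM, w'; split.
- by rewrite uE u1E; apply/mnmP => z; rewrite !mnmDE addnA.
- by rewrite mdegD !mdeg1.
- by rewrite pushD !push1 fx fy.
- by rewrite pushD !push1 fx' fy'.
- by rewrite !pushD !push1 gx' gy'.
Qed.

End Lift.

(* The pairs of indices form a set of cells of an n1 x n2 array which, once the
   rows and the columns are sorted by type, is closed under moving up or left. *)
Definition staircase (T : finType) n n1 n2 (b : 'I_n -> {set T})
    (b1 : 'I_n1 -> {set T}) (b2 : 'I_n2 -> {set T})
    (f1 : 'I_n -> 'I_n1) (f2 : 'I_n -> 'I_n2) (t1 : 'I_n1 -> bool)
    (t2 : 'I_n2 -> bool) : Prop :=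
  [/\ forall u v, fib b u v =
        fib b1 (push f1 u) (push f1 v) && fib b2 (push f2 u) (push f2 v),
      forall p q, f1 p = f1 q -> f2 p = f2 q -> p = q,
      forall p i j, t1 i <= t1 (f1 p) -> t2 j <= t2 (f2 p) ->
        exists2 q, f1 q = i & f2 q = j,
      forall i j k l, fib b1 (U_(i) + U_(j))%MM (U_(k) + U_(l))%MM ->
        t1 i = t1 k /\ t1 j = t1 l \/ t1 i = t1 l /\ t1 j = t1 k
    & forall i j k l, fib b2 (U_(i) + U_(j))%MM (U_(k) + U_(l))%MM ->
        t2 i = t2 k /\ t2 j = t2 l \/ t2 i = t2 l /\ t2 j = t2 k].

Definition rank_by n (t : 'I_n -> bool) (i : 'I_n) : nat := t i * n + i.

Lemma rank_by_inj n (t : 'I_n -> bool) : injective (rank_by t).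
Proof.
move=> i j; rewrite /rank_by => E; apply: val_inj => /=.
have := ltn_ord i; have := ltn_ord j; move: E.
by case: (t i); case: (t j) => /=; lia.
Qed.

Lemma rank_by_type n (t : 'I_n -> bool) i j :
  rank_by t i < rank_by t j -> t i <= t j.
Proof.
rewrite /rank_by; have := ltn_ord i; have := ltn_ord j.
by case: (t i); case: (t j) => //=; lia.
Qed.

Section Staircase.
Variables (T : finType) (n n1 n2 : nat) (b : 'I_n -> {set T}).
Variables (b1 : 'I_n1 -> {set T}) (b2 : 'I_n2 -> {set T}).
Variables (f1 : 'I_n -> 'I_n1) (f2 : 'I_n -> 'I_n2).
Variables (t1 : 'I_n1 -> bool) (t2 : 'I_n2 -> bool).
Hypothesis S : staircase b b1 b2 f1 f2 t1 t2.
Implicit Types u v w : 'X_{1..n}.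

Let r1 p := rank_by t1 (f1 p).
Let r2 p := rank_by t2 (f2 p).
Let r p := r1 p * (n2 + n2) + r2 p.

Let r2_lt p : r2 p < n2 + n2.
Proof.
rewrite /r2 /rank_by; have := ltn_ord (f2 p); case: (t2 _) => /=; lia.
Qed.

Let lt_r p q : (r p < r q) = (r1 p < r1 q) || (r1 p == r1 q) && (r2 p < r2 q).
Proof.
have := r2_lt p; have := r2_lt q; rewrite /r => a c.
case: (ltngtP (r1 p) (r1 q)) => [lt|lt|->] /=; last by rewrite ltn_add2l.
  apply: (@leq_trans ((r1 p).+1 * (n2 + n2))); first by rewrite mulSn; lia.
  by apply: leq_trans (leq_addr _ _); rewrite leq_mul2r lt orbT.
apply/negbTE; rewrite -leqNgt.
apply: (@leq_trans ((r1 q).+1 * (n2 + n2))); first by rewrite mulSn; lia.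
by apply: leq_trans (leq_addr _ _); rewrite leq_mul2r lt orbT.
Qed.

Let r_inj : injective r.
Proof.
case: S => _ inj _ _ _ p q E.
have : r1 p = r1 q /\ r2 p = r2 q.
  have := lt_r p q; have := lt_r q p; rewrite E ltnn.
  by case: (ltngtP (r1 p)) => //= ->; case: (ltngtP (r2 p)).
by case=> /rank_by_inj E1 /rank_by_inj E2; apply: inj.
Qed.

Let weight u := \sum_(p < n) u p * (r1 p * r2 p).

Let weightD u v : weight (u + v)%MM = weight u + weight v.
Proof.
by rewrite /weight -big_split; apply: eq_bigr => i _; rewrite mnmDE mulnDl.
Qed.

Let weight1 p : weight U_(p)%MM = r1 p * r2 p.
Proof.
rewrite /weight (bigD1 p) //= mnm1E eqxx mul1n big1 ?addn0 // => q qp.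
by rewrite mnm1E (eq_sym p) (negbTE qp).
Qed.

Let sum_push_cond k (f : 'I_n -> 'I_k) (P : pred 'I_k) u v :
  push f u = push f v ->
  \sum_(p < n | P (f p)) u p = \sum_(p < n | P (f p)) v p.
Proof.
have E w : \sum_(p < n | P (f p)) w p = \sum_(j < k) push f w j * P j.
  rewrite sum_push big_mkcond; apply: eq_bigr => p _.
  by case: (P _); rewrite ?muln1 ?muln0.
by rewrite !E => ->.
Qed.

(* At the first cell where two monomials with the same row and column sums
   differ, comparing the sums over the columns to the right of that cell
   shows that the larger monomial has a cell strictly below and to the right. *)
Lemma diagonal_pair u v p : push f1 u = push f1 v -> push f2 u = push f2 v ->
    v p < u p -> (forall q, r q < r p -> v q = u q) ->
  exists q, [/\ 0 < u q, r1 p < r1 q & r2 p < r2 q].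
Proof.
move=> E1 E2 vu eq_lt.
case: (pickP (fun q => [&& 0 < u q, r1 p < r1 q & r2 p < r2 q])) => [q|no].
  by case/and3P; exists q.
exfalso.
have col := @sum_push_cond _ f2 (fun j => r2 p < rank_by t2 j) _ _ E2.
have row := @sum_push_cond _ f1 (fun i => i == f1 p) _ _ E1.
have r1E q : (f1 q == f1 p) = (r1 q == r1 p).
  by apply/eqP/eqP => [|/rank_by_inj //]; rewrite /r1 => ->.
move: row; rewrite (bigID (fun q => r2 p < r2 q)).
rewrite [RHS](bigID (fun q => r2 p < r2 q)) /=.
move: col; rewrite (bigID (fun q => f1 q == f1 p)).
rewrite [RHS](bigID (fun q => f1 q == f1 p)) /=.
under [\sum_(q < n | _ && (r2 p < r2 q)) u q]eq_bigl do rewrite andbC.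
under [\sum_(q < n | _ && (r2 p < r2 q)) v q]eq_bigl do rewrite andbC.
set A := \sum_(q | _ && _) _; set B := \sum_(q | _ && _) _.
set A' := \sum_(q | _ && _) _; set B' := \sum_(q | _ && _) _.
set C := \sum_(q | _ && _) _; set C' := \sum_(q | _ && _) _.
have le_AB : A' <= B'.
  apply: leq_sum => q /andP[q2]; rewrite r1E => q1.
  case: (ltngtP (r1 q) (r1 p)) => lt; last by rewrite lt eqxx in q1.
    by rewrite eq_lt // lt_r lt.
  by have := no q; rewrite lt q2 !andbT; case: (u q).
have lt_C : C' < C.
  have pP : (f1 p == f1 p) && ~~ (r2 p < r2 p) by rewrite eqxx ltnn.
  rewrite /C /C' (bigD1 p pP) [ltnRHS](bigD1 p pP) /=.
  rewrite -addSn leq_add //; apply: leq_sum => q /andP[/andP[q1 q2] qp].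
  rewrite r1E in q1; rewrite eq_lt // lt_r q1 orbC /= ltn_neqAle leqNgt q2 andbT.
  case: eqP => // E; case/eqP: qp; apply: r_inj.
  by rewrite /r E (eqP q1).
lia.
Qed.

Lemma diagonal_swap u v : push f1 u = push f1 v -> push f2 u = push f2 v ->
    lexlt r v u ->
  exists p q w, [/\ u = (p + w)%MM, mdeg p = 2, push f1 q = push f1 p,
    push f2 q = push f2 p & lexlt r q p /\ weight q < weight p].
Proof.
move=> E1 E2 /lexltP[x vx eq_lt].
have [y [uy r1xy r2xy]] := diagonal_pair E1 E2 vx eq_lt.
case: (S) => _ _ fill _ _.
have [x' f1x' f2x'] := fill y (f1 x) (f2 y) (rank_by_type r1xy) (leqnn _).
have [y' f1y' f2y'] := fill y (f1 y) (f2 x) (leqnn _) (rank_by_type r2xy).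
have r1x' : r1 x' = r1 x by rewrite /r1 f1x'.
have r2x' : r2 x' = r2 y by rewrite /r2 f2x'.
have r1y' : r1 y' = r1 y by rewrite /r1 f1y'.
have r2y' : r2 y' = r2 x by rewrite /r2 f2y'.
have neq z : r x < r z -> z == x = false.
  by case: eqP => // ->; rewrite ltnn.
have xy : r x < r y by rewrite lt_r r1xy.
have xx' : r x < r x' by rewrite lt_r r1x' r2x' eqxx r2xy orbT.
have xy' : r x < r y' by rewrite lt_r r1y' r1xy.
have [u1 u1E] := mnm_pick (leq_ltn_trans (leq0n _) vx).
have u1y : 0 < u1 y.
  by move: uy; rewrite u1E mnmDE mnm1E eq_sym neq.
have [w wE] := mnm_pick u1y.
exists (U_(x) + U_(y))%MM, (U_(x') + U_(y'))%MM, w; split.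
- by rewrite u1E wE; apply/mnmP => z; rewrite !mnmDE addnA.
- by rewrite mdegD !mdeg1.
- by rewrite !pushD !push1 f1x' f1y'.
- by rewrite !pushD !push1 f2x' f2y'; apply/mnmP => z; rewrite !mnmDE addnC.
split.
  apply/lexltP; exists x; rewrite ?mnmDE ?mnm1E ?eqxx ?neq //.
  move=> z zx; rewrite !mnmDE !mnm1E.
  have ne z' : r x <= r z' -> z' == z = false.
    by case: eqP => // ->; rewrite leqNgt zx.
  by rewrite !ne // ltnW.
rewrite !weightD !weight1 r1x' r2x' r1y' r2y'; nia.
Qed.

Let push_fib u v : push f1 u = push f1 v -> push f2 u = push f2 v -> fib b u v.
Proof. by case: S => -> _ _ _ _ -> ->; rewrite !fib_refl. Qed.

Let lift1 u (p w q : 'X_{1..n1}) : push f1 u = (p + w)%MM -> mdeg p = 2 ->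
    fib b1 p q ->
  exists p' q' w', [/\ u = (p' + w')%MM, mdeg p' = 2, push f1 p' = p,
    push f1 q' = q & push f2 q' = push f2 p'].
Proof.
case: (S) => _ _ fill t1_fib _; apply: lift_quadratic t1_fib _ _ _ _ _.
by move=> x i E; apply: fill; rewrite ?E.
Qed.

Let lift2 u (p w q : 'X_{1..n2}) : push f2 u = (p + w)%MM -> mdeg p = 2 ->
    fib b2 p q ->
  exists p' q' w', [/\ u = (p' + w')%MM, mdeg p' = 2, push f2 p' = p,
    push f2 q' = q & push f1 q' = push f1 p'].
Proof.
case: (S) => _ _ fill _ t2_fib; apply: lift_quadratic t2_fib _ _ _ _ _.
move=> x j E; have [||y] := fill x (f1 x) j; rewrite ?E //.
by exists y.
Qed.

Lemma staircase_quad_groebner :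
  quad_groebner b1 -> quad_groebner b2 -> quad_groebner b.
Proof.
move=> [le1 ord1 gb1] [le2 ord2 gb2].
exists (lexcomp (push f1) le1 (lexcomp (push f2) le2 (lexle r))).
  by do 2?[apply: lexcomp_monomial_order => //; rewrite ?push0 //;
    first exact: pushD]; exact: lexle_monomial_order.
move=> u v; case: (S) => fibE _ _ _ _.
rewrite fibE => /andP[fib1 fib2]; rewrite /lexcomp.
case: (push f1 v =P push f1 u) => [E1|/eqP ne1]; last first.
  move=> le_vu _; have [p [q [w [E dp pq qp nqp]]]] := gb1 _ _ fib1 le_vu ne1.
  have [p' [q' [w' [uE dp' p'E q'E pq2]]]] := lift1 E dp pq.
  exists p', q', w'; split=> //.
  - by rewrite fibE p'E q'E pq pq2 fib_refl.
  - by rewrite p'E q'E (negbTE nqp).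
  - by apply: contra nqp => /eqP E'; rewrite -p'E -q'E E'.
case: (push f2 v =P push f2 u) => [E2|/eqP ne2]; last first.
  move=> le_vu _; have [p [q [w [E dp pq qp nqp]]]] := gb2 _ _ fib2 le_vu ne2.
  have [p' [q' [w' [uE dp' p'E q'E pq1]]]] := lift2 E dp pq.
  exists p', q', w'; split=> //.
  - by rewrite fibE p'E q'E pq pq1 fib_refl.
  - by rewrite p'E q'E pq1 eqxx (negbTE nqp).
  - by apply: contra nqp => /eqP E'; rewrite -p'E -q'E E'.
rewrite /lexle => /orP[-> //|lt _].
have [p [q [w [uE dp q1 q2 [qp _]]]]] := diagonal_swap (esym E1) (esym E2) lt.
exists p, q, w; split=> //.
- exact: push_fib.
- by rewrite q1 q2 !eqxx qp orbT.
- by apply: contraTneq qp => ->; rewrite lexlt_irr.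
Qed.

Let conn_same_push k u v : weight u + weight v < k ->
  push f1 u = push f1 v -> push f2 u = push f2 v -> conn b u v.
Proof.
elim: k u v => // k IH u v lt E1 E2.
have descend x y : weight x + weight y <= k -> push f1 x = push f1 y ->
    push f2 x = push f2 y -> lexlt r y x -> conn b x y.
  move=> le {}E1 {}E2 yx.
  have [p [q [w [xE dp q1 q2 [_ wt]]]]] := diagonal_swap E1 E2 yx.
  apply: (@conn_trans _ _ _ _ (q + w)%MM).
    apply: (conn_step xE dp _ (conn_refl _ _)).
    exact: push_fib.
  apply: IH.
  - by move: le; rewrite xE !weightD; lia.
  - by rewrite -E1 xE !pushD q1.
  - by rewrite -E2 xE !pushD q2.
have [->|/(lexlt_total r) /orP[uv|vu]] := eqVneq u v; first exact: conn_refl.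
  by apply: conn_sym; apply: descend; rewrite // addnC.
exact: descend.
Qed.

Lemma staircase_quad_connected :
  quad_connected b1 -> quad_connected b2 -> quad_connected b.
Proof.
move=> c1 c2 u v; case: (S) => fibE _ _ _ _.
have along1 x : conn b1 (push f1 u) x ->
    exists u', [/\ conn b u u', push f1 u' = x & push f2 u' = push f2 u].
  elim=> [|x' p q w -> dp pq _ [u' [uu' E1 E2]]].
    by exists u; split=> //; exact: conn_refl.
  have [p' [q' [w' [uE dp' p'E q'E pq2]]]] := lift1 E1 dp pq.
  have wE : push f1 w' = w.
    by apply: (@mnm_addKl _ p); rewrite -E1 uE pushD p'E.
  exists (q' + w')%MM; split.
  - apply: conn_step uE dp' _ uu'.
    by rewrite fibE p'E q'E pq pq2 fib_refl.
  - by rewrite pushD q'E wE.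
  - by rewrite -E2 uE !pushD pq2.
have along2 u1 x : conn b2 (push f2 u1) x ->
    exists u', [/\ conn b u1 u', push f2 u' = x & push f1 u' = push f1 u1].
  elim=> [|x' p q w -> dp pq _ [u' [uu' E2 E1]]].
    by exists u1; split=> //; exact: conn_refl.
  have [p' [q' [w' [uE dp' p'E q'E pq1]]]] := lift2 E2 dp pq.
  have wE : push f2 w' = w.
    by apply: (@mnm_addKl _ p); rewrite -E2 uE pushD p'E.
  exists (q' + w')%MM; split.
  - apply: conn_step uE dp' _ uu'.
    by rewrite fibE p'E q'E pq pq1 fib_refl.
  - by rewrite pushD q'E wE.
  - by rewrite -E1 uE !pushD pq1.
rewrite fibE => /andP[/c1 /along1[u1 [uu1 E11 E12]]] /c2.
rewrite -E12 => /along2[u2 [u12 E22 E21]].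
apply: conn_trans uu1 (conn_trans u12 _).
by apply: conn_same_push (ltnSn _) _ _; rewrite ?E21.
Qed.

End Staircase.

(** * Matroids *)

Section MatroidBases.
Variable T : finType.
Implicit Types (M N : basis_system T) (B C D : {set T}) (c x y z : T).

Lemma card_bases M B D : is_matroid M ->
  B \in bases M -> D \in bases M -> #|B| = #|D|.
Proof.
case=> _ _ exch; move: {2}#|B :\: D| (leqnn #|B :\: D|) => k.
elim: k B => [|k IH] B le BM DM.
  have BD : B \subset D by rewrite -setD_eq0 -cards_eq0 -leqn0.
  have DB : D \subset B.
    apply/subsetP => x xD; apply: contraT => xB.
    have [|y] := exch D B DM BM x; first by rewrite inE xB.
    by rewrite inE => /andP[/negP yD /(subsetP BD)].
  by congr #|pred_of_set _|; apply/eqP; rewrite eqEsubset BD.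
have [E|[x xBD]] := set_0Vmem (B :\: D); first by apply: IH; rewrite // E cards0.
have [y] := exch B D BM DM x xBD; rewrite inE => /andP[yB yD] B'M.
move: (xBD); rewrite inE => /andP[xD xB].
rewrite -(IH (y |: (B :\ x))) //.
  by rewrite cardsU1 !inE (negbTE yB) andbF (cardsD1 x B) xB.
rewrite -ltnS; apply: leq_trans le; rewrite (cardsD1 x (B :\: D)) xBD ltnS.
apply/subset_leq_card/subsetP => z; rewrite !inE.
by case: (z =P y) => [->|_] /=; [rewrite yD|case: (z == x); case: (z \in D)].
Qed.

(* Among the bases containing x and [B :&: D], one with the largest
   intersection with B differs from B only by x. *)
Lemma dual_exchange M B D x : is_matroid M ->
    B \in bases M -> D \in bases M -> x \in D :\: B ->
  exists2 y, y \in B :\: D & x |: (B :\ y) \in bases M.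
Proof.
move=> MM BM DM; rewrite inE => /andP[xB xD]; have [_ _ exch] := MM.
pose P C := [&& C \in bases M, x \in C & B :&: D \subset C].
have PD : P D by rewrite /P DM xD subsetIr.
case: (@arg_maxnP _ D P (fun C => #|C :&: B|) PD) => C /and3P[CM xC BDC] maxC.
have CE : C = x |: (C :&: B).
  apply/setP => z; rewrite !inE; case: (z =P x) => [->|/eqP zx] //=.
  apply/idP/andP=> [zC|[] //]; split=> //; apply: contraT => zB.
  have [|y] := exch C B CM BM z; first by rewrite inE zB.
  rewrite inE => /andP[yC yB] C'M; have /maxC : P (y |: (C :\ z)).
    rewrite /P C'M !inE (eq_sym x z) zx xC orbT /=; apply/subsetP => w wBD.
    rewrite !inE (subsetP BDC) // andbT; case: (w =P z) => [E|_]; rewrite ?orbT //.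
    by move: wBD zB; rewrite inE E => /andP[->].
  suff -> : (y |: (C :\ z)) :&: B = y |: (C :&: B).
    by rewrite cardsU1 inE (negbTE yC) /= ltnn.
  apply/setP => w; rewrite !inE; case: (w =P y) => [->|_] /=; first by rewrite yB.
  by case: (w =P z) => [->|_] //=; rewrite (negbTE zB) andbF.
have cC := card_bases MM CM BM.
have cCB : #|C :&: B|.+1 = #|B|.
  by rewrite -cC [in RHS]CE cardsU1 inE (negbTE xB) andbF.
have [y yB yC] : exists2 y, y \in B & y \notin C.
  apply/subsetPn; apply/negP => /setIidPr E.
  by move: cCB; rewrite E => /eqP; rewrite eqn_leq ltnn.
exists y.
  by rewrite inE yB andbT; apply: contra yC => yD; rewrite (subsetP BDC) // inE yB.
suff <- : C :&: B = B :\ y by rewrite -CE.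
apply/eqP; rewrite eqEcard; apply/andP; split.
  apply/subsetP => z; rewrite !inE => /andP[zC ->]; rewrite andbT.
  by apply: contraNneq yC => <-.
by move: cCB; rewrite (cardsD1 y B) yB => -[->].
Qed.

Lemma setD_involutive B C : B \subset C -> C :\: (C :\: B) = B.
Proof. by move=> BC; rewrite setDDr setDv set0U (setIidPr BC). Qed.

Lemma mem_dual M B : is_matroid M ->
  (B \in bases (dual M)) = (B \subset ground M) && (ground M :\: B \in bases M).
Proof.
case=> _ sub _; apply/imsetP/andP => [[D DM ->]|[BE DM]].
  by rewrite subsetDl setD_involutive ?sub.
by exists (ground M :\: B) => //; rewrite setD_involutive.
Qed.

Lemma is_matroid_dual M : is_matroid M -> is_matroid (dual M).
Proof.
move=> MM; have [/set0Pn[B0 B0M] sub exch] := MM; split.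
- by apply/set0Pn; exists (ground M :\: B0); apply: imset_f.
- by move=> B; rewrite mem_dual // => /andP[].
move=> B D; rewrite !mem_dual // => /andP[BE BM] /andP[DE DM] x.
rewrite inE => /andP[xD xB].
have [|y] := @dual_exchange M _ _ x MM BM DM.
  by rewrite !inE xB xD (subsetP BE).
rewrite !inE => /andP[ynD /andP[yB yE]] yM.
have yD : y \in D by move: ynD; rewrite yE andbT negbK.
exists y; first by rewrite inE yB.
rewrite mem_dual // subUset sub1set yE (subset_trans (subD1set _ _)) //=.
suff -> : ground M :\: (y |: B :\ x) = x |: (ground M :\: B) :\ y by [].
apply/setP => z; rewrite !inE; case: (z =P x) => [->|_] /=.
  rewrite (subsetP BE) // !andbT orbF.
  by apply: contraNneq xD => ->.
by case: (z == y).
Qed.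

Lemma coloop_dual M c : is_matroid M -> coloop (dual M) c = loop M c.
Proof.
case=> _ sub _; rewrite /coloop /loop /=; case cE: (c \in ground M) => //=.
apply/forall_inP/forall_inP => h B.
  by move=> BM; have := h _ (imset_f _ BM); rewrite inE cE andbT.
by case/imsetP => D /h cD ->; rewrite inE cE andbT.
Qed.

Lemma nloopP M c : c \in ground M -> ~~ loop M c ->
  exists2 B, B \in bases M & c \in B.
Proof.
rewrite /loop => ->; rewrite negb_forall_in => /exists_inP[B BM].
by rewrite negbK; exists B.
Qed.

Lemma ncoloopP M c : c \in ground M -> ~~ coloop M c ->
  exists2 B, B \in bases M & c \notin B.
Proof.
by rewrite /coloop => ->; rewrite negb_forall_in => /exists_inP[B BM]; exists B.
Qed.

Lemma is_matroid_deletion M c : is_matroid M -> is_matroid (deletion M c).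
Proof.
move=> [/set0Pn[B0 B0M] sub exch]; rewrite /deletion.
case: ifP => [/andP[cE /forall_inP col]|/negbT ncol]; split=> /=.
- by apply/set0Pn; exists (B0 :\ c); apply: imset_f.
- by move=> _ /imsetP[B /sub BE ->]; apply: setSD.
- move=> _ _ /imsetP[B BM ->] /imsetP[D DM ->] x; rewrite !inE => xBD.
  have [|y] := exch B D BM DM x.
    by case/and3P: xBD => xD xc xB; move: xD; rewrite inE xc xB andbT.
  rewrite inE => /andP[yB yD] yM.
  have yc : y != c by apply: contraNneq yB => ->; exact: col.
  exists y; first by rewrite !inE (negbTE yB) yc yD andbF.
  apply/imsetP; exists (y |: B :\ x) => //; apply/setP => z; rewrite !inE.
  by case: (z =P y) => [->|_] //=; [rewrite yc|case: (z == c); rewrite ?andbF].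
- have [cE|cE] := boolP (c \in ground M).
    have [B BM cB] := ncoloopP cE ncol.
    by apply/set0Pn; exists B; rewrite inE BM.
  apply/set0Pn; exists B0; rewrite inE B0M /=; apply: contra cE.
  exact: (subsetP (sub _ B0M)).
- move=> B; rewrite inE => /andP[/sub BE cB]; apply/subsetP => x xB.
  by rewrite !inE (subsetP BE) // andbT; apply: contraNneq cB => <-.
- move=> B D; rewrite !inE => /andP[BM cB] /andP[DM cD] x xBD.
  have [y yDB yM] := exch B D BM DM x xBD; exists y => //.
  rewrite inE yM !inE (negbTE cB) andbF orbF.
  by apply: contraNneq cD => ->; move: yDB; rewrite inE => /andP[].
Qed.

Lemma mem_contraction M c B : is_matroid M -> c \in ground M -> ~~ loop M c ->
  B \in bases (contraction M c) -> c |: B \in bases M.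
Proof.
move=> MM cE nl; have [_ sub _] := MM; have MD := is_matroid_dual MM.
rewrite mem_dual; last exact: is_matroid_deletion.
case/andP => BE; rewrite /deletion coloop_dual // (negbTE nl) inE mem_dual //=.
case/andP => /andP[_]; rewrite !inE cE !andbT => h cB.
suff <- : ground M :\: ((ground M :\ c) :\: B) = c |: B by [].
apply/setP => z; rewrite !inE; case: (z =P c) => [->|zc] /=.
  by rewrite cE andbF.
case zB: (z \in B) => /=; last by rewrite andNb.
by move: (subsetP BE z zB); rewrite !inE => /andP[].
Qed.

Lemma disjointsU1 x B D :
  [disjoint x |: B & D] = (x \notin D) && [disjoint B & D].
Proof. by rewrite -setI_eq0 setIUl setU_eq0 !setI_eq0 disjoints1. Qed.

Definition join M N : basis_system T :=
  BasisSystem (ground M :|: ground N)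
    [set B :|: D | B in bases M, D in bases N & B :&: D == set0].

Lemma mem_joinP M N F :
  reflect (exists B D, [/\ B \in bases M, D \in bases N, [disjoint B & D]
                         & F = B :|: D]) (F \in bases (join M N)).
Proof.
apply: (iffP imset2P) => [[B D BM]|[B [D [BM DN BD ->]]]].
  by rewrite inE setI_eq0 => /andP[DN BD] ->; exists B, D.
by exists B D; rewrite // inE setI_eq0 DN.
Qed.

Lemma joinC M N : join M N = join N M.
Proof.
rewrite /join setUC; congr BasisSystem; apply/setP => F.
by apply/imset2P/imset2P => -[B D BM]; rewrite inE setIC => /andP[DN BD] ->;
  exists D B; rewrite ?inE ?BM ?DN // setUC.
Qed.

Lemma join_exchange M N c B D B' D' x : is_matroid M -> is_matroid N ->
    ground M :&: ground N \subset [set c] ->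
    B \in bases M -> D \in bases N -> [disjoint B & D] ->
    B' \in bases M -> D' \in bases N -> [disjoint B' & D'] ->
    x \in B -> x \notin B' :|: D' ->
  exists2 y, y \in (B' :|: D') :\: (B :|: D) &
    y |: ((B :|: D) :\ x) \in bases (join M N).
Proof.
move=> [_ subM exM] [_ subN exN] /subsetP EE BM DN BD B'M D'N BD' xB.
rewrite inE negb_or => /andP[xB' xD'].
have only_c z X Y : X \in bases M -> Y \in bases N -> z \in X -> z \in Y -> z = c.
  move=> /subM/subsetP XM /subN/subsetP YN /XM zM /YN zN.
  by apply/set1P/EE; rewrite inE zM.
have xD : x \notin D by rewrite (disjointFr BD).
have [|y] := exM B B' BM B'M x; first by rewrite inE xB'.
rewrite inE => /andP[yB yB'] B1M.
have yx : y != x by apply: contraNneq yB => ->.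
have [yD|yD] := boolP (y \in D); last first.
  exists y; first by rewrite !inE yB' (negbTE yB) (negbTE yD).
  apply/mem_joinP; exists (y |: B :\ x), D; split=> //.
    rewrite disjointsU1 yD (disjointWl _ BD) //; exact: subD1set.
  apply/setP => z; rewrite !inE; case: (z =P x) => [->|_] /=; last by rewrite orbA.
  by rewrite (negbTE xD) !orbF.
have yc := only_c _ _ _ B'M DN yB' yD.
have yD' : y \notin D' by rewrite (disjointFr BD').
have [|z] := exN D D' DN D'N y; first by rewrite inE yD'.
rewrite inE => /andP[zD zD'] D1N.
have zB : z \notin B.
  apply: contra zD => zB; by rewrite (only_c _ _ _ BM D'N zB zD') -yc.
exists z; first by rewrite !inE zD' (negbTE zB) (negbTE zD) orbT.
have zy : y != z by apply: contraNneq zD => <-.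
apply/mem_joinP; exists (y |: B :\ x), (z |: D :\ y); split=> //.
  rewrite disjointsU1 !inE negb_or zy eqxx /=.
  rewrite disjoint_sym disjointsU1 !inE negb_and zB orbT /=.
  rewrite disjoint_sym (disjointWl (subD1set _ _)) //.
  by rewrite (disjointWr (subD1set _ _)).
apply/setP => w; rewrite !inE.
case: (w =P z) => [->|_]; first by rewrite !orbT.
case: (w =P y) => [->|_] /=; first by rewrite yx yD orbT.
by case: (w =P x) => [->|_] //=; rewrite (negbTE xD).
Qed.

Lemma is_matroid_join M N c : is_matroid M -> is_matroid N ->
  ground M :&: ground N \subset [set c] -> bases (join M N) != set0 ->
  is_matroid (join M N).
Proof.
move=> MM NM EE ne; have [_ subM _] := MM; have [_ subN _] := NM; split=> //.
  move=> _ /mem_joinP[B [D [/subM BM /subN DN _ ->]]].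
  by apply: setUSS.
move=> _ _ /mem_joinP[B [D [BM DN BD ->]]] /mem_joinP[B' [D' [B'M D'N BD' ->]]] x.
rewrite inE => /andP[xF']; rewrite inE => /orP[xB|xD].
  exact: (join_exchange MM NM EE).
rewrite joinC (setUC B) (setUC B').
apply: (@join_exchange _ _ c) => //; rewrite 1?disjoint_sym //.
  by rewrite setIC.
by rewrite setUC.
Qed.

Lemma direct_sum_join M N : is_matroid M -> is_matroid N ->
  [disjoint ground M & ground N] -> direct_sum M N = join M N.
Proof.
move=> [_ subM _] [_ subN _] dis; congr BasisSystem; apply/setP => F.
apply/imset2P/mem_joinP => [[B D BM DN ->]|[B [D [BM DN _ ->]]]].
  exists B, D; split=> //; apply: disjointWl (subM _ BM) _.
  exact: disjointWr (subN _ DN) _.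
by exists B D.
Qed.

Lemma join_ne_set0 M N c : c \in ground M -> ~~ coloop M c ->
  is_matroid N -> (forall x, x \in ground M -> x \in ground N -> x = c) ->
  is_matroid M -> bases (join M N) != set0.
Proof.
move=> cM ncol [/set0Pn[D DN] subN _] only [_ subM _].
have [B BM cB] := ncoloopP cM ncol.
apply/set0Pn; exists (B :|: D); apply/mem_joinP; exists B, D; split=> //.
rewrite disjoint_subset; apply/subsetP => x xB; rewrite inE; apply/negP => xD.
by case/negP: cB; rewrite -(only x) ?(subsetP (subM _ BM)) ?(subsetP (subN _ DN)).
Qed.

Lemma parallel_dual M N c : is_matroid M -> is_matroid N ->
  ground M :&: ground N = [set c] ->
  ~~ loop M c -> ~~ coloop M c -> ~~ loop N c -> ~~ coloop N c ->
  parallel M N c = dual (join (dual M) (dual N)).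
Proof.
move=> [_ subM _] [_ subN _] hc l1 c1 l2 c2.
rewrite /parallel (negbTE l1) (negbTE c1) (negbTE l2) (negbTE c2).
rewrite /dual /join /=; congr BasisSystem.
have inE1 z B : B \in bases M -> z \in B -> z \in ground M.
  by move=> /subM/subsetP; apply.
have inE2 z D : D \in bases N -> z \in D -> z \in ground N.
  by move=> /subN/subsetP; apply.
have EE z : (z \in ground M) && (z \in ground N) = (z == c).
  by have := in_set1 z c; rewrite -hc inE.
have compl B D : B \in bases M -> D \in bases N -> (c \in B) || (c \in D) ->
    (ground M :|: ground N) :\: ((ground M :\: B) :|: (ground N :\: D)) =
    if c \in B :&: D then B :|: D else (B :|: D) :\ c.
  move=> BM DN cBD; apply/setP => z; rewrite (fun_if (fun X : {set T} => z \in X)).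
  rewrite !inE.
  have := inE1 z B BM; have := inE2 z D DN; have := EE z; move: cBD.
  case: (z =P c) => [->|_].
    by case: (c \in B); case: (c \in D); case: (c \in ground M);
      case: (c \in ground N).
  rewrite if_same.
  case: (z \in B); case: (z \in D); case: (z \in ground M);
    case: (z \in ground N) => //= _ _ h1 h2;
    by rewrite ?(h1 isT) ?(h2 isT) //; move: (h1 isT) (h2 isT).
have disj B D : (ground M :\: B) :&: (ground N :\: D) == set0 =
    ((c \in B) || (c \in D)).
  apply/eqP/orP => [E|cBD].
    have : c \notin (ground M :\: B) :&: (ground N :\: D) by rewrite E inE.
    rewrite !inE; have := EE c; rewrite eqxx => /andP[-> ->].
    by rewrite !andbT negb_and !negbK => /orP.
  apply/setP => z; rewrite !inE; have := EE z; case: (z =P c) => [->|_].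
    by case: cBD => ->; rewrite ?andbF.
  by case: (z \in ground M); case: (z \in ground N); rewrite ?andbF.
apply/setP => F; apply/setUP/imsetP.
  case=> /imset2P[B D BM]; rewrite inE => /andP[DN cBD] ->;
  exists ((ground M :\: B) :|: (ground N :\: D)).
  - apply/imset2P; exists (ground M :\: B) (ground N :\: D) => //.
      exact: imset_f.
    rewrite inE disj imset_f //=; move: cBD; rewrite inE.
    by case: (c \in B).
  - rewrite compl // ?cBD //.
    by move: cBD; rewrite inE => /andP[->].
  - apply/imset2P; exists (ground M :\: B) (ground N :\: D) => //.
      exact: imset_f.
    rewrite inE disj imset_f //=; move: cBD.
    by case: (c \in B).
  - rewrite compl // ?inE; move: cBD; by case: (c \in B); case: (c \in D).
case=> G /imset2P[_ Y /imsetP[B BM ->]]; rewrite inE => /andP[/imsetP[D DN ->]].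
rewrite disj => cBD -> ->; rewrite compl //.
case: ifP => cI; [left|right]; apply/imset2P; exists B D; rewrite // inE DN //=.
by move: cI cBD; rewrite inE; case: (c \in B); case: (c \in D).
Qed.

End MatroidBases.

(** * Closure properties *)

Section Closure.
Variable T : finType.
Implicit Types (M N : basis_system T) (B C D : {set T}) (A : {set {set T}}).

Definition basis_family M (j : 'I_#|bases M|) : {set T} := enum_val j.

Lemma enum_val_onto (U : finType) (A : {set U}) x :
  x \in A -> exists j : 'I_#|A|, enum_val j = x.
Proof. by move=> xA; exists (enum_rank_in xA x); rewrite enum_rankK_in. Qed.

Lemma index_map A A' (R : {set T} -> {set T} -> Prop) :
  (forall B, B \in A' -> exists2 D, D \in A & R B D) ->
  exists f : 'I_#|A'| -> 'I_#|A|, forall j, R (enum_val j) (enum_val (f j)).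
Proof.
move=> h; apply: (fin_all_exists (P := fun j k => R (enum_val j) (enum_val k))).
move=> j; have [D DA RD] := h _ (enum_valP j).
by have [k kE] := enum_val_onto DA; exists k; rewrite kE.
Qed.

Lemma fib_eq_inc n n' (b : 'I_n -> {set T}) (b' : 'I_n' -> {set T})
    (u v : 'X_{1..n}) (u' v' : 'X_{1..n'}) :
  mdeg u = mdeg u' -> mdeg v = mdeg v' ->
  (mdeg u = mdeg v ->
    forall e, inc b u e = inc b v e <-> inc b' u' e = inc b' v' e) ->
  fib b u v = fib b' u' v'.
Proof.
move=> du dv h; apply/fibP/fibP => -[d E]; split; rewrite -?du -?dv //.
  by move=> e; apply/h.
  by rewrite du dv.
by move=> e; apply/h; rewrite // du dv.
Qed.

Lemma dual_face M : is_matroid M ->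
  exists f, face_map (@basis_family (dual M)) (@basis_family M) f.
Proof.
move=> MM; have [_ sub _] := MM.
have [|f fE] := @index_map (bases M) (bases (dual M))
    (fun B D => B \subset ground M /\ D = ground M :\: B).
  by move=> B; rewrite mem_dual // => /andP[BE DM]; exists (ground M :\: B).
have f_inj : injective f.
  move=> j k E; apply: enum_val_inj.
  have [jE jD] := fE j; have [kE kD] := fE k.
  by rewrite -(setD_involutive jE) -(setD_involutive kE) -jD -kD E.
have incE u e : inc (@basis_family M) (push f u) e
    + inc (@basis_family (dual M)) u e = (e \in ground M) * mdeg u.
  rewrite inc_push /inc -big_split mulnC mdegE big_distrl /=.
  apply: eq_bigr => j _; rewrite -mulnDr /basis_family; have [jE ->] := fE j.
  rewrite inE; case eB: (e \in enum_val j) => //=; last by rewrite addn0.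
  by rewrite (subsetP jE).
exists f; split=> //.
  move=> u v; apply: fib_eq_inc; rewrite ?mdeg_push // => d e.
  by have := incE u e; have := incE v e; rewrite d; split; lia.
move=> u v _ i _.
have [|j jE] := @enum_val_onto _ (bases (dual M)) (ground M :\: basis_family i).
  by rewrite mem_dual // subsetDl setD_involutive ?sub ?enum_valP.
apply/codomP; exists j; apply: enum_val_inj; have [_ ->] := fE j.
by rewrite jE setD_involutive ?sub ?enum_valP.
Qed.

Lemma deletion_face M c : is_matroid M ->
  exists f, face_map (@basis_family (deletion M c)) (@basis_family M) f.
Proof.
move=> [_ sub _].
have [col|ncol] := boolP (coloop M c).
  have cB i : c \in @basis_family M i.
    by case/andP: col => _ /forall_inP; apply; apply: enum_valP.
  have delE B : (B \in bases (deletion M c)) = (c |: B \in bases M) && (c \notin B).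
    rewrite /deletion col /=; apply/imsetP/andP => [[D DM ->]|[BM cB']].
      by rewrite setD11 setD1K //; case/andP: col => _ /forall_inP; apply.
    by exists (c |: B) => //; rewrite setU1K.
  have [|f fE] := @index_map (bases M) (bases (deletion M c))
      (fun B D => c \notin B /\ D = c |: B).
    by move=> B; rewrite delE => /andP[BM cB']; exists (c |: B).
  have f_inj : injective f.
    move=> j k E; apply: enum_val_inj.
    have [jc jD] := fE j; have [kc kD] := fE k.
    by rewrite -(setU1K jc) -(setU1K kc) -jD -kD E.
  have incE u e : inc (@basis_family M) (push f u) e =
      inc (@basis_family (deletion M c)) u e + (e == c) * mdeg u.
    rewrite inc_push /inc mulnC mdegE big_distrl /= -big_split /=.
    apply: eq_bigr => j _; rewrite -mulnDr /basis_family; have [jc ->] := fE j.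
    rewrite !inE; case: (e =P c) => [->|_] /=; last by rewrite addn0.
    by rewrite (negbTE jc).
  exists f; split=> //.
    move=> u v; apply: fib_eq_inc; rewrite ?mdeg_push // => d e.
    by rewrite !incE d; split; lia.
  move=> u v _ i _.
  have [|j jE] := @enum_val_onto _ (bases (deletion M c)) (basis_family i :\ c).
    by rewrite delE setD11 setD1K // enum_valP.
  apply/codomP; exists j; apply: enum_val_inj; have [_ ->] := fE j.
  by rewrite jE setD1K.
have delE B : (B \in bases (deletion M c)) = (B \in bases M) && (c \notin B).
  by rewrite /deletion (negbTE ncol) /= inE.
have [|f fE] := @index_map (bases M) (bases (deletion M c))
    (fun B D => c \notin B /\ D = B).
  by move=> B; rewrite delE => /andP[BM cB']; exists B.
have incE u e : inc (@basis_family M) (push f u) e =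
    inc (@basis_family (deletion M c)) u e.
  rewrite inc_push; apply: eq_bigr => j _.
  by rewrite /basis_family /=; have [_ ->] := fE j.
exists f; split.
- move=> j k E; apply: enum_val_inj.
  by have [_ <-] := fE j; have [_ <-] := fE k; rewrite E.
- by move=> u v; apply: fib_eq_inc; rewrite ?mdeg_push // => _ e; rewrite !incE.
move=> u v /fibP[_ /(_ c)]; rewrite incE => E i vi.
have {}E : inc (@basis_family M) v c = 0.
  rewrite -E; apply: big1 => j _; rewrite /basis_family.
  by have [/negbTE -> _] := fE j; rewrite muln0.
have ci : c \notin basis_family i.
  move/eqP: E; rewrite /inc sum_nat_eq0 => /forallP /(_ i) /=.
  by rewrite muln_eq0 (negbTE vi) /= eqb0.
have [|j jE] := @enum_val_onto _ (bases (deletion M c)) (basis_family i).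
  by rewrite delE ci enum_valP.
apply/codomP; exists j; apply: enum_val_inj; have [_ ->] := fE j.
by rewrite jE.
Qed.

Lemma sum_inc n (b : 'I_n -> {set T}) k (u : 'X_{1..n}) :
  (forall i, #|b i| = k) -> \sum_e inc b u e = mdeg u * k.
Proof.
move=> bk; rewrite /inc exchange_big mdegE big_distrl /=.
apply: eq_bigr => i _; rewrite -big_distrr /= -(bk i) -sum1_card [in RHS]big_mkcond.
by congr (_ * _); apply: eq_bigr => e _; case: (_ \in _).
Qed.

Lemma pair_types n (b : 'I_n -> {set T}) c i j k l :
  fib b (U_(i) + U_(j))%MM (U_(k) + U_(l))%MM ->
  (c \in b i) = (c \in b k) /\ (c \in b j) = (c \in b l) \/
  (c \in b i) = (c \in b l) /\ (c \in b j) = (c \in b k).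
Proof.
move=> /fibP[_ /(_ c)]; rewrite !incD !inc1.
by case: (c \in b i); case: (c \in b j); case: (c \in b k); case: (c \in b l);
  auto.
Qed.

Lemma join_staircase M N c : is_matroid M -> is_matroid N ->
    ground M :&: ground N \subset [set c] ->
  exists f1 f2 t1 t2, staircase (@basis_family (join M N)) (@basis_family M)
    (@basis_family N) f1 f2 t1 t2.
Proof.
move=> MM NM /subsetP EE; have [_ subM _] := MM; have [_ subN _] := NM.
have only_c z X Y : X \in bases M -> Y \in bases N -> z \in X -> z \in Y -> z = c.
  move=> /subM/subsetP XM /subN/subsetP YN /XM zM /YN zN.
  by apply/set1P/EE; rewrite inE zM.
have [h hE] : exists h : 'I_#|bases (join M N)| -> 'I_#|bases M| * 'I_#|bases N|,
    forall p, [disjoint basis_family (h p).1 & basis_family (h p).2] /\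
      basis_family p = basis_family (h p).1 :|: basis_family (h p).2.
  apply: (fin_all_exists (P := fun p ij => [disjoint basis_family ij.1
    & basis_family ij.2] /\
    basis_family p = basis_family ij.1 :|: basis_family ij.2)) => p.
  have /mem_joinP[B [D [BM DN BD pE]]] := enum_valP p.
  have [i iE] := enum_val_onto BM; have [j jE] := enum_val_onto DN.
  by exists (i, j); rewrite /basis_family /= iE jE.
pose f1 p := (h p).1; pose f2 p := (h p).2.
exists f1, f2, (fun i => c \in basis_family i), (fun j => c \in basis_family j).
have incE u e : inc (@basis_family (join M N)) u e =
    inc (@basis_family M) (push f1 u) e + inc (@basis_family N) (push f2 u) e.
  rewrite !inc_push /inc -big_split; apply: eq_bigr => p _ /=.
  have [dis ->] := hE p; rewrite -mulnDr inE.
  case e1: (e \in basis_family (h p).1) => //=.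
  by rewrite (disjointFr dis).
have inc0 P (u : 'X_{1..#|bases P|}) e : is_matroid P -> e \notin ground P ->
    inc (@basis_family P) u e = 0.
  move=> [_ subP _] eP; apply: big1 => i _.
  suff /negbTE-> : e \notin basis_family i by rewrite muln0.
  by apply: contra eP; apply/subsetP/subP/enum_valP.
have off_c P (u v : 'X_{1..#|bases P|}) : is_matroid P -> mdeg u = mdeg v ->
    (forall e, e != c -> inc (@basis_family P) u e = inc (@basis_family P) v e) ->
    forall e, inc (@basis_family P) u e = inc (@basis_family P) v e.
  move=> PM d E e; have [->|] := eqVneq e c; last exact: E.
  have [/set0Pn[B BP] _ _] := PM.
  have cardB i : #|@basis_family P i| = #|B| by apply: card_bases (enum_valP i) BP.
  have := sum_inc v cardB; rewrite -d -(sum_inc u cardB).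
  rewrite (bigD1 c) //= [in RHS](bigD1 c) //=.
  rewrite [X in _ + X](eq_bigr (fun e => inc (@basis_family P) u e)).
    by move/addIn.
  by move=> i /E.
have h_onto i j : ~~ ((c \in basis_family i) && (c \in basis_family j)) ->
    exists2 q, f1 q = i & f2 q = j.
  move=> ncc; have ij : [disjoint basis_family i & basis_family j].
    rewrite disjoint_subset; apply/subsetP => z zi; rewrite inE.
    apply: contra ncc => zj.
    by rewrite -(only_c z _ _ (enum_valP i) (enum_valP j)) ?zi.
  have [|q qE] := @enum_val_onto _ (bases (join M N))
      (basis_family i :|: basis_family j).
    by apply/mem_joinP; exists (basis_family i), (basis_family j);
      rewrite !enum_valP.
  have [qd qE'] := hE q; have {}qE' : basis_family (f1 q) :|: basis_family (f2 q)
      = basis_family i :|: basis_family j by rewrite -qE' -qE.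
  have parts P (x y : 'I_#|bases P|) : is_matroid P ->
      (forall z, z != c -> (z \in basis_family x) = (z \in basis_family y)) ->
      x = y.
    move=> PM E; apply: enum_val_inj; apply/setP => z.
    have [->|] := eqVneq z c; last exact: E.
    have := card_bases PM (enum_valP x) (enum_valP y).
    rewrite (cardsD1 c) [RHS](cardsD1 c).
    have -> : enum_val x :\ c = enum_val y :\ c.
      apply/setP => w; rewrite !inE; case: eqP => //= /eqP; exact: E.
    by move/addIn; do 2!case: (c \in _).
  have mem1 z (x : 'I_#|bases M|) : z \in basis_family x -> z \in ground M.
    by apply/subsetP/subM/enum_valP.
  have mem2 z (x : 'I_#|bases N|) : z \in basis_family x -> z \in ground N.
    by apply/subsetP/subN/enum_valP.
  have split_c z : z != c -> ~~ ((z \in ground M) && (z \in ground N)).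
    by apply: contra => zz; apply/eqP/set1P/EE; rewrite inE.
  exists q; apply: parts => // z zc; have := split_c z zc;
    have /setP /(_ z) := qE'; rewrite !inE;
    have := mem1 z (f1 q); have := mem1 z i;
    have := mem2 z (f2 q); have := mem2 z j;
    case: (z \in ground M); case: (z \in ground N) => //=;
    case: (z \in basis_family i); case: (z \in basis_family j);
    case: (z \in basis_family (f1 q)); case: (z \in basis_family (f2 q)) => //=;
    by do ?[done | move/(_ isT) | move=> _].
split.
- move=> u v; apply/idP/andP => [/fibP[d E]|[/fibP[d E1] /fibP[_ E2]]]; last first.
    move: d; rewrite !mdeg_push => d; apply/fibP; split=> // e.
    by rewrite !incE E1 E2.
  have split_c e : e != c -> e \notin ground M \/ e \notin ground N.
    move=> ec; apply/orP; rewrite -negb_and; apply: contra ec => ee.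
    by apply/eqP/set1P/EE; rewrite inE.
  split; apply/fibP; rewrite !mdeg_push; split=> //; apply: off_c;
    rewrite ?mdeg_push // => e /split_c[e1|e2]; have := E e; rewrite !incE.
  + by rewrite !(inc0 M).
  + by rewrite !(inc0 N) // !addn0.
  + by rewrite !(inc0 M).
  + by rewrite !(inc0 N) // !addn0.
- move=> p q E1 E2; apply: enum_val_inj.
  rewrite -/(basis_family p) -/(basis_family q).
  by have [_ ->] := hE p; have [_ ->] := hE q; rewrite -/(f1 p) -/(f2 p) E1 E2.
- move=> p i j le1 le2; apply: h_onto; have [dis _] := hE p.
  apply/negP => /andP[ci cj]; move: le1 le2; rewrite ci cj !lt0b => cp1.
  by rewrite (disjointFr dis cp1).
- by move=> i j k l; apply: pair_types.
- by move=> i j k l; apply: pair_types.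
Qed.

Variable Q : forall n, ('I_n -> {set T}) -> Prop.
Hypothesis Q_face : forall m n (b' : 'I_m -> {set T}) (b : 'I_n -> {set T}) f,
  face_map b' b f -> Q b -> Q b'.
Hypothesis Q_staircase : forall n n1 n2 (b : 'I_n -> {set T})
    (b1 : 'I_n1 -> {set T}) (b2 : 'I_n2 -> {set T}) f1 f2 t1 t2,
  staircase b b1 b2 f1 f2 t1 t2 -> Q b1 -> Q b2 -> Q b.

Definition class M : Prop := is_matroid M /\ Q (@basis_family M).

Lemma class_dual M : class M -> class (dual M).
Proof.
move=> [MM QM]; split; first exact: is_matroid_dual.
by have [f /Q_face] := dual_face MM; apply.
Qed.

Lemma class_deletion M c : class M -> class (deletion M c).
Proof.
move=> [MM QM]; split; first exact: is_matroid_deletion.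
by have [f /Q_face] := deletion_face c MM; apply.
Qed.

Lemma class_contraction M c : class M -> class (contraction M c).
Proof. by move=> CM; exact/class_dual/class_deletion/class_dual. Qed.

Lemma class_join M N c : class M -> class N ->
  ground M :&: ground N \subset [set c] -> bases (join M N) != set0 ->
  class (join M N).
Proof.
move=> [MM QM] [NM QN] EE ne; split; first exact: is_matroid_join EE ne.
by have [f1 [f2 [t1 [t2 /Q_staircase]]]] := join_staircase MM NM EE; apply.
Qed.

(* The toric ideal of a matroid of rank 0 is generated by [x - 1]. *)
Definition pos_class M : Prop := class M /\ set0 \notin bases M.

Lemma pos_class_direct_sum M N : class M -> class N ->
  [disjoint ground M & ground N] ->
  (set0 \notin bases M) || (set0 \notin bases N) ->
  pos_class (direct_sum M N).
Proof.
move=> CM CN dis pos; have [MM _] := CM; have [NM _] := CN; split; last first.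
  apply: contraL pos => /imset2P[B D BM DN /esym/eqP].
  rewrite setU_eq0 => /andP[/eqP B0 /eqP D0].
  by rewrite B0 in BM; rewrite D0 in DN; rewrite BM DN.
have [/set0Pn[B BM] _ _] := MM; have [/set0Pn[D DN] _ _] := NM.
have [c _|T0] := pickP (@predT T); last first.
  suff e0 (X : {set T}) : X = set0.
    by rewrite (e0 B) in BM; rewrite (e0 D) in DN; rewrite BM DN in pos.
  by apply/setP => z; have := T0 z.
rewrite direct_sum_join //; apply: (@class_join _ _ c) => //.
  by move: dis; rewrite -setI_eq0 => /eqP ->; apply: sub0set.
rewrite -direct_sum_join //; apply/set0Pn; exists (B :|: D).
by apply/imset2P; exists B D.
Qed.

Section Connections.
Variables (M1 M2 : basis_system T) (c : T).
Hypothesis hc : ground M1 :&: ground M2 = [set c].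
Hypotheses (P1 : pos_class M1) (P2 : pos_class M2).

Let C1 : class M1. Proof. by case: P1. Qed.
Let C2 : class M2. Proof. by case: P2. Qed.
Let MM1 : is_matroid M1. Proof. by case: C1. Qed.
Let MM2 : is_matroid M2. Proof. by case: C2. Qed.
Let nz1 : set0 \notin bases M1. Proof. by case: P1. Qed.
Let nz2 : set0 \notin bases M2. Proof. by case: P2. Qed.
Let sub_c : ground M1 :&: ground M2 \subset [set c]. Proof. by rewrite hc. Qed.
Let c1 : c \in ground M1.
Proof. by have := set11 c; rewrite -hc inE => /andP[]. Qed.
Let c2 : c \in ground M2.
Proof. by have := set11 c; rewrite -hc inE => /andP[]. Qed.

Let disl : [disjoint ground M1 :\ c & ground M2].
Proof. by rewrite -setI_eq0 setIDAC hc setDv. Qed.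
Let disr : [disjoint ground M1 & ground M2 :\ c].
Proof. by rewrite -setI_eq0 setIDA hc setDv. Qed.

Let only_c x : x \in ground M1 -> x \in ground M2 -> x = c.
Proof. by move=> x1 x2; apply/set1P; rewrite -hc inE x1. Qed.

Let series_join : ~~ loop M1 c -> ~~ coloop M1 c -> ~~ loop M2 c ->
  ~~ coloop M2 c -> series M1 M2 c = join M1 M2.
Proof.
by rewrite /series => /negbTE-> /negbTE-> /negbTE-> /negbTE->.
Qed.

Let set0_join : set0 \notin bases (join M1 M2).
Proof.
apply/mem_joinP => -[B [D [BM _ _ /esym/eqP]]].
by rewrite setU_eq0 => /andP[/eqP B0 _]; move: nz1; rewrite -B0 BM.
Qed.

Lemma pos_class_series : pos_class (series M1 M2 c).
Proof.
rewrite /series; case: ifP => l1; [|case: ifP => k1; [|case: ifP => l2;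
  [|case: ifP => k2]]].
- by apply: pos_class_direct_sum; rewrite ?nz2 ?orbT //; exact: class_contraction.
- by apply: pos_class_direct_sum; rewrite ?nz1 //; exact: class_deletion.
- by apply: pos_class_direct_sum; rewrite ?nz1 //; exact: class_contraction.
- by apply: pos_class_direct_sum; rewrite ?nz2 ?orbT //; exact: class_deletion.
split; last exact: set0_join.
apply: (@class_join _ _ c) => //; apply: (@join_ne_set0 _ _ _ c) => //.
by rewrite k1.
Qed.

Lemma pos_class_parallel : pos_class (parallel M1 M2 c).
Proof.
have [l1|l1] := boolP (loop M1 c).
  rewrite /parallel l1; apply: pos_class_direct_sum; rewrite ?nz1 //.
  exact: class_contraction.
have [k1|k1] := boolP (coloop M1 c).
  rewrite /parallel (negbTE l1) k1.
  apply: pos_class_direct_sum; rewrite ?nz2 ?orbT //; exact: class_deletion.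
have [l2|l2] := boolP (loop M2 c).
  rewrite /parallel (negbTE l1) (negbTE k1) l2.
  apply: pos_class_direct_sum; rewrite ?nz2 ?orbT //; exact: class_contraction.
have [k2|k2] := boolP (coloop M2 c).
  rewrite /parallel (negbTE l1) (negbTE k1) (negbTE l2) k2.
  apply: pos_class_direct_sum; rewrite ?nz1 //; exact: class_deletion.
split.
  rewrite parallel_dual //; apply/class_dual/(@class_join _ _ c);
    [exact: class_dual..|by []|].
  apply: (@join_ne_set0 _ _ _ c) => //; try exact: is_matroid_dual.
  by rewrite coloop_dual.
rewrite /parallel (negbTE l1) (negbTE k1) (negbTE l2) (negbTE k2) /=.
apply/setUP => -[] /imset2P[B D BM]; rewrite inE => /andP[DN cBD] /esym E.
  by move/setP/(_ c): E; move: cBD; rewrite !inE => /andP[-> ->].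
have sub z : z \in B :|: D -> z = c.
  move=> zBD; apply/eqP; apply: contraT => zc.
  by move/setP/(_ z): E; rewrite !inE zc /=; move: zBD; rewrite inE => ->.
have [cB|cB] := boolP (c \in B).
  have D0 : D = set0.
    apply/setP => z; rewrite inE; apply/negP => zD.
    by move: cBD; rewrite cB -(sub z) ?inE zD ?orbT //= addTb zD.
  by move: nz2; rewrite -D0 DN.
have B0 : B = set0.
  apply/setP => z; rewrite inE; apply/negP => zB.
  by case/negP: cB; rewrite -(sub z) // inE zB.
by move: nz1; rewrite -B0 BM.
Qed.

Lemma pos_class_two_sum : ~~ loop M1 c -> ~~ coloop M1 c -> ~~ loop M2 c ->
  ~~ coloop M2 c -> pos_class (two_sum M1 M2 c).
Proof.
move=> l1 k1 l2 k2; have [CS _] := pos_class_series; have [MS _] := CS.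
split; first exact: class_contraction.
apply/negP => /mem_contraction; rewrite series_join // in MS *; move/(_ MS).
rewrite inE c1 => /(_ isT) h.
have [B BM cB] := nloopP c1 l1; have [D DN cD] := ncoloopP c2 k2.
have /h {h} : ~~ loop (join M1 M2) c.
  rewrite /loop negb_and negb_forall_in; apply/orP; right; apply/exists_inP.
  exists (B :|: D); last by rewrite negbK inE cB.
  apply/mem_joinP; exists B, D; split=> //.
  rewrite disjoint_subset; apply/subsetP => z zB; rewrite inE.
  have [_ sub1 _] := MM1; have [_ sub2 _] := MM2.
  apply: contra cD => zD.
  by rewrite -(only_c (subsetP (sub1 _ BM) _ zB) (subsetP (sub2 _ DN) _ zD)).
rewrite setU0 => /mem_joinP[B' [D' [B'M D'N dis E]]].
have [E0|[x xB]] := set_0Vmem B'; first by move: nz1; rewrite -E0 B'M.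
have [E0|[y yD]] := set_0Vmem D'; first by move: nz2; rewrite -E0 D'N.
have xc : x = c by apply/set1P; rewrite E inE xB.
have yc : y = c by apply/set1P; rewrite E inE yD orbT.
by have := disjointFr dis xB; rewrite xc -yc yD.
Qed.

End Connections.
End Closure.

(** * Toric ideals *)

Local Open Scope ring_scope.

Section IdealSpan.
Variable R : comNzRingType.
Implicit Types (S : R -> Prop) (p q : R).

Lemma ideal_span_gen S p : S p -> ideal_span S p.
Proof.
move=> Sp; exists 1%N, (fun=> 1), (fun=> p); split=> //.
by rewrite big_ord1 mul1r.
Qed.

Lemma ideal_span0 S : ideal_span S 0.
Proof.
exists 0%N, (fun=> 0), (fun=> 0); split=> [[]//|].
by rewrite big_ord0.
Qed.

Lemma ideal_spanM S a p : ideal_span S p -> ideal_span S (a * p).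
Proof.
move=> [k [b [g [Sg ->]]]]; exists k, (fun i => a * b i), g; split=> //.
by rewrite big_distrr; apply: eq_bigr => i _; rewrite /= mulrA.
Qed.

Lemma ideal_spanD S p q :
  ideal_span S p -> ideal_span S q -> ideal_span S (p + q).
Proof.
move=> [k [a [g [Sg ->]]]] [l [b [h [Sh ->]]]].
exists (k + l)%N, (fun i => match split i with inl j => a j | inr j => b j end),
  (fun i => match split i with inl j => g j | inr j => h j end); split.
  by move=> i; case: (split i).
rewrite big_split_ord /=; congr (_ + _); apply: eq_bigr => i _.
  by rewrite (unsplitK (inl i)).
by rewrite (unsplitK (inr i)).
Qed.

Lemma ideal_span_sum S k (F : 'I_k -> R) :
  (forall i, ideal_span S (F i)) -> ideal_span S (\sum_(i < k) F i).
Proof.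
by move=> h; elim/big_ind: _ => //; [exact: ideal_span0|exact: ideal_spanD].
Qed.

Lemma ideal_span_sub S S' p :
  (forall g, S g -> ideal_span S' g) -> ideal_span S p -> ideal_span S' p.
Proof.
move=> SS' [k [a [g [Sg ->]]]]; apply: ideal_span_sum => i.
exact/ideal_spanM/SS'.
Qed.

End IdealSpan.

Section MonomialCoefficients.
Variables (K : fieldType) (n : nat).
Implicit Types (a p q : {mpoly K[n]}) (s t u v : 'X_{1..n}).

Lemma mcoeff_mulX p s u : (p * 'X_[s])@_u =
  \sum_(j <- msupp p) p@_j * ((j + s)%MM == u)%:R.
Proof.
rewrite {1}[p]mpolyE big_distrl raddf_sum /=; apply: eq_bigr => j _.
by rewrite -scalerAl mcoeffZ -mpolyXD mcoeffX.
Qed.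

Lemma mcoeff_mulX_neq0 p s u : (p * 'X_[s])@_u != 0 ->
  exists w, u = (s + w)%MM.
Proof.
rewrite mcoeff_mulX => nz.
have [/hasP[j _ /eqP <-]|no] := boolP (has (fun j => (j + s)%MM == u) (msupp p)).
  by exists j; apply/mnmP => z; rewrite !mnmDE addnC.
move: nz; rewrite big_seq big1 ?eqxx // => j jp.
by rewrite (negbTE (hasPn no j jp)) mulr0.
Qed.

Lemma sum_mcoeff_mulX k (C : pred 'X_{1..n}) a s : (msize a + mdeg s <= k)%N ->
  \sum_(m : 'X_{1..n < k} | C m) (a * 'X_[s])@_m =
  \sum_(j <- msupp a) a@_j * (C (j + s)%MM)%:R.
Proof.
move=> le; under eq_bigr do rewrite mcoeff_mulX.
rewrite exchange_big /= [LHS]big_seq [RHS]big_seq; apply: eq_bigr => j ja.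
rewrite -big_distrr /=; congr (_ * _).
have lt : (mdeg (j + s) < k)%N.
  rewrite mdegD; apply: leq_trans le; rewrite -addSn leq_add2r.
  exact: msize_mdeg_lt.
case Cjs: (C (j + s)%MM); last first.
  by rewrite big1 // => m Cm; case: eqP Cm => // <-; rewrite Cjs.
rewrite (bigD1 (BMultinom lt)) //= eqxx big1 ?addr0 // => m /andP[_ ne].
by rewrite eq_sym -[_ == _]/(m == BMultinom lt) (negbTE ne).
Qed.

Lemma mem_msupp_binomial s t u : s != t ->
  (u \in msupp ('X_[s] - 'X_[t] : {mpoly K[n]})) = (u == s) || (u == t).
Proof.
move=> st; rewrite mcoeff_msupp mcoeffB !mcoeffX (eq_sym s) (eq_sym t).
have [->|_] := eqVneq u s; first by rewrite (negbTE st) subr0 oner_eq0.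
by case: (u == t); rewrite sub0r ?oppr0 ?eqxx // oppr_eq0 oner_eq0.
Qed.

Lemma monomial_in_span (S : {mpoly K[n]} -> Prop) u :
  (forall g, S g -> exists s, g = 'X_[s]) -> ideal_span S 'X_[u] ->
  exists s w, S 'X_[s] /\ u = (s + w)%MM.
Proof.
move=> mono [k [a [g [Sg uE]]]].
have : (\sum_(i < k) a i * g i)@_u != 0 by rewrite -uE mcoeffX eqxx oner_eq0.
rewrite raddf_sum /=.
case: (pickP (fun i => (a i * g i)@_u != 0)) => [i nz _|no]; last first.
  by rewrite big1 ?eqxx // => i _; apply/eqP; have := no i => /negbT; rewrite negbK.
have [s gE] := mono _ (Sg i); move: nz; rewrite gE => /mcoeff_mulX_neq0[w uw].
by exists s, w; rewrite -gE.
Qed.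

End MonomialCoefficients.

Section ToricMonomials.
Variables (K : fieldType) (T : finType) (M : basis_system T).
Hypothesis sub_ground : forall B, B \in bases M -> B \subset ground M.
Local Notation n := #|bases M|.
Local Notation b := (@basis_family T M).
Implicit Types (p : {mpoly K[n]}) (u v s t : 'X_{1..n}).

Definition image_mnm u : 'X_{1..#|ground M|} :=
  [multinom inc b u (enum_val e) | e < #|ground M|].

Lemma toric_mapX u :
  toric_map ('X_[u] : {mpoly K[n]}) = 'X_[image_mnm u].
Proof.
rewrite /toric_map comp_mpolyX.
under eq_bigr do rewrite tnth_mktuple mprodXE.
rewrite mprodXnE; congr 'X_[_]; apply/mnmP => e; rewrite mnm_sumE mnmE.
apply: eq_bigr => j _; rewrite mulmnE mnm_sumE mulnC; congr (_ * _)%N.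
rewrite big_mkcond (bigD1 e) //= mnm1E eqxx big1 ?addn0 => [|i ie].
  by rewrite /basis_family; case: ifP.
by rewrite mnm1E (negbTE ie) if_same.
Qed.

Lemma toric_map_sum p :
  toric_map p = \sum_(m <- msupp p) p@_m *: 'X_[image_mnm m].
Proof.
rewrite /toric_map comp_mpolyEX; apply: eq_bigr => m _.
by rewrite -/(toric_map _) toric_mapX.
Qed.

Lemma toric_idealD p q : toric_ideal p -> toric_ideal q -> toric_ideal (p + q).
Proof.
by rewrite /toric_ideal /toric_map raddfD /= => -> ->; rewrite addr0.
Qed.

Lemma toric_idealM p q : toric_ideal q -> toric_ideal (p * q).
Proof. by rewrite /toric_ideal /toric_map rmorphM /= => ->; rewrite mulr0. Qed.

Lemma toric_ideal_span (S : {mpoly K[n]} -> Prop) p :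
  (forall g, S g -> toric_ideal g) -> ideal_span S p -> toric_ideal p.
Proof.
move=> SJ [k [a [g [Sg ->]]]]; elim/big_ind: _ => //.
- by rewrite /toric_ideal /toric_map raddf0.
- exact: toric_idealD.
- by move=> i _; apply/toric_idealM/SJ.
Qed.

Lemma image_mnmP u v :
  image_mnm u = image_mnm v <-> forall e, inc b u e = inc b v e.
Proof.
split=> [E e|E]; last by apply/mnmP => i; rewrite !mnmE.
have [/enum_val_onto[i <-]|eM] := boolP (e \in ground M).
  by move/mnmP/(_ i): E; rewrite !mnmE.
have inc0 w : inc b w e = 0%N.
  apply: big1 => i _; suff /negbTE-> : e \notin b i by rewrite muln0.
  by apply: contra eM; apply/subsetP/sub_ground/enum_valP.
by rewrite !inc0.
Qed.

Lemma toric_binomialP s t :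
  toric_ideal ('X_[s] - 'X_[t] : {mpoly K[n]}) <-> image_mnm s = image_mnm t.
Proof.
rewrite /toric_ideal /toric_map raddfB /= -!/(toric_map _) !toric_mapX.
split=> [/eqP|->]; last by rewrite subrr.
rewrite subr_eq0 => /eqP /mpolyP /(_ (image_mnm t)); rewrite !mcoeffX eqxx.
by case: eqP => // _ /eqP; rewrite eq_sym oner_eq0.
Qed.

Lemma toric_partner p u : toric_ideal p -> u \in msupp p ->
  exists v, [/\ v \in msupp p, v != u & image_mnm u = image_mnm v].
Proof.
rewrite /toric_ideal toric_map_sum => pJ up.
have [/hasP[v vp /andP[vu /eqP uv]]|no] :=
  boolP (has (fun v => (v != u) && (image_mnm u == image_mnm v)) (msupp p)).
  by exists v.
have /eqP := mcoeff0 K (image_mnm u); rewrite -pJ raddf_sum /=.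
rewrite (bigD1_seq u) ?msupp_uniq //= mcoeffZ mcoeffX eqxx mulr1.
rewrite big_seq_cond big1 ?addr0 => [|v /andP[vp vu]].
  by move: up; rewrite mcoeff_msupp => /negbTE ->.
move/hasPn/(_ v vp): no; rewrite vu /= => /negbTE nv.
by rewrite mcoeffZ mcoeffX eq_sym nv mulr0.
Qed.

Hypothesis MM : is_matroid M.

Lemma image_mnm_fib u v : set0 \notin bases M ->
  image_mnm u = image_mnm v <-> fib b u v.
Proof.
move=> nz; split=> [/image_mnmP E|/fibP[_ E]]; last exact/image_mnmP.
apply/fibP; split=> //; have [/set0Pn[B BM] _ _] := MM.
have cardB i : #|b i| = #|B| by apply: card_bases (enum_valP i) BM.
have B0 : (0 < #|B|)%N.
  by rewrite card_gt0; apply: contraNneq nz => <-.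
apply/eqP; rewrite -(eqn_pmul2r B0) -(sum_inc u cardB) -(sum_inc v cardB).
by apply/eqP; apply: eq_bigr => e _; apply: E.
Qed.

Definition quadrics : seq {mpoly K[n]} :=
  [seq 'X_[(x : 'X_{1..n < 3} * 'X_{1..n < 3}).1] - 'X_[x.2] |
    x : 'X_{1..n < 3} * 'X_{1..n < 3} in
    [pred x : 'X_{1..n < 3} * 'X_{1..n < 3} |
      [&& mdeg x.1 == 2%N, fib b x.1 x.2 & (x.1 : 'X_{1..n}) != x.2]]].

Lemma quadricsP p : p \in quadrics <-> exists s t,
  [/\ mdeg s = 2%N, fib b s t, s != t & p = 'X_[s] - 'X_[t]].
Proof.
split=> [/imageP[[s t] /= /and3P[/eqP ds st nst] ->]|[s [t [ds st nst ->]]]].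
  by exists s, t.
have dt : mdeg t = 2%N by case/fibP: st => <-.
have ls : (mdeg s < 3)%N by rewrite ds.
have lt : (mdeg t < 3)%N by rewrite dt.
apply/imageP; exists (BMultinom ls, BMultinom lt) => //=.
by rewrite inE /= ds st.
Qed.

Lemma quadrics_quadratic p : p \in quadrics -> quadratic_binomial p.
Proof.
move=> /quadricsP[s [t [ds st nst ->]]]; exists s, t; split=> //.
by case/fibP: st => <-.
Qed.

Lemma quadrics_toric p : p \in quadrics -> toric_ideal p.
Proof.
move=> /quadricsP[s [t [ds /fibP[_ E] nst ->]]].
exact/toric_binomialP/image_mnmP.
Qed.

Lemma quadratic_toric p : quadratic_binomial p -> toric_ideal p ->
  exists s t, [/\ s != t, mdeg s = 2%N, fib b s t & p = 'X_[s] - 'X_[t]].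
Proof.
move=> [s [t [st ds dt ->]]] /toric_binomialP/image_mnmP E.
by exists s, t; split=> //; apply/fibP; rewrite ds dt.
Qed.

Lemma conn_ideal_span u v : conn b u v ->
  ideal_span (fun g => g \in quadrics) ('X_[u] - 'X_[v]).
Proof.
elim=> [|v' p q w -> dp pq _ IH]; first by rewrite subrr; exact: ideal_span0.
have -> : 'X_[u] - 'X_[(q + w)%MM] = ('X_[u] - 'X_[(p + w)%MM]) +
    'X_[w] * ('X_[p] - 'X_[q]) :> {mpoly K[n]}.
  by rewrite !mpolyXD mulrBr !(mulrC 'X_[w]) addrA subrK.
apply: ideal_spanD IH _; apply: ideal_spanM.
have [->|npq] := eqVneq p q; first by rewrite subrr; exact: ideal_span0.
by apply: ideal_span_gen; apply/quadricsP; exists p, q.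
Qed.

Lemma quad_connected_MQ :
  set0 \notin bases M -> quad_connected b -> MQ K M.
Proof.
move=> nz cb; split=> //; exists quadrics; split; last exact: quadrics_quadratic.
move=> p; split; last by apply: toric_ideal_span; exact: quadrics_toric.
move: {2}(size (msupp p)) (leqnn (size (msupp p))) => k.
elim: k p => [|k IH] p.
  rewrite leqn0 size_eq0 msupp_eq0 => /eqP -> _; exact: ideal_span0.
move=> le pJ; case sE: (msupp p) => [|u r].
  by move/eqP: sE; rewrite msupp_eq0 => /eqP ->; exact: ideal_span0.
have up : u \in msupp p by rewrite sE mem_head.
have [v [vp vu uv]] := toric_partner pJ up.
have uvJ : toric_ideal ('X_[u] - 'X_[v] : {mpoly K[n]}) by apply/toric_binomialP.
pose p' := p - p@_u *: ('X_[u] - 'X_[v]).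
have -> : p = p' + (p@_u)%:MP * ('X_[u] - 'X_[v]) by rewrite mul_mpolyC subrK.
apply: ideal_spanD; last first.
  by apply/ideal_spanM/conn_ideal_span/cb/image_mnm_fib.
apply: IH; last first.
  rewrite /p' -mul_mpolyC -mulNr; apply: toric_idealD pJ _; exact: toric_idealM.
have sub : {subset msupp p' <= rem u (msupp p)}.
  move=> m; rewrite mem_rem_uniq ?msupp_uniq // inE !mcoeff_msupp.
  rewrite /p' mcoeffB mcoeffZ mcoeffB !mcoeffX [u == m]eq_sym.
  have [->|mu] /= := eqVneq m u; first by rewrite (negbTE vu) subr0 mulr1 subrr eqxx.
  have [<- _|_] := eqVneq v m; first by rewrite -mcoeff_msupp.
  by rewrite subr0 mulr0 subr0.
have := uniq_leq_size (msupp_uniq p') sub; rewrite size_rem //.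
by move=> h; apply: leq_trans h _; rewrite -ltnS prednK // sE.
Qed.

(* The sum of the coefficients over a connected component vanishes on every
   multiple of a quadratic binomial of the toric ideal. *)
Lemma MQ_quad_connected : MQ K M -> quad_connected b.
Proof.
move=> [_ [G [JG quadG]]] u v uv.
have GJ g : g \in G -> toric_ideal g by move=> gG; apply/JG/ideal_span_gen.
have /JG[k [a [g [gG uvE]]]] : toric_ideal ('X_[u] - 'X_[v] : {mpoly K[n]}).
  by apply/toric_binomialP/image_mnmP; case/fibP: uv.
pose C w : bool := excluded_middle_informative (conn b u w).
have CP w : C w <-> conn b u w by rewrite /C; case: excluded_middle_informative.
pose d := (\max_(i < k) msize (a i) + mdeg u + 2)%N.
have coefX w : mdeg w = mdeg u ->
    \sum_(m : 'X_{1..n < d} | C m) ('X_[w] : {mpoly K[n]})@_m = (C w)%:R.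
  move=> dw; rewrite -['X_[w]]mul1r sum_mcoeff_mulX.
    by rewrite msupp1 big_seq1 mcoeffC eqxx mulr1 mul1r add0m.
  by rewrite -mpolyX0 msizeX mdeg0 dw /d; lia.
have : (C u)%:R - (C v)%:R = 0 :> K.
  rewrite -!coefX //; last by case/fibP: uv.
  rewrite -sumrB; under eq_bigr do rewrite -mcoeffB uvE raddf_sum /=.
  rewrite exchange_big big1 //= => i _.
  have [s [t [_ ds st ->]]] := quadratic_toric (quadG _ (gG i)) (GJ _ (gG i)).
  under eq_bigr do rewrite mulrBr mcoeffB.
  have dt : mdeg t = 2%N by case/fibP: st => <-.
  have le : (msize (a i) + 2 <= d)%N.
    rewrite /d leq_add2r; apply: leq_trans (leq_addr _ _).
    exact: (leq_bigmax (F := fun i => msize (a i))).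
  rewrite sumrB !sum_mcoeff_mulX ?ds ?dt //; apply/eqP; rewrite subr_eq0; apply/eqP.
  apply: eq_bigr => j _; suff -> : C (j + s)%MM = C (j + t)%MM by [].
  have swap w : (j + w = w + j)%MM by apply/mnmP => z; rewrite !mnmDE addnC.
  rewrite !swap; apply/idP/idP => /CP cu; apply/CP.
    exact: conn_step ds st cu.
  by rewrite fib_sym in st; exact: conn_step dt st cu.
have -> : C u by apply/CP; exact: conn_refl.
case Cv: (C v); first by move=> _; apply/CP.
by move/eqP; rewrite subr0 oner_eq0.
Qed.

Lemma toric_rank0 : set0 \in bases M ->
  exists j, toric_ideal ('X_[U_(j)] - 'X_[0%MM] : {mpoly K[n]}).
Proof.
move=> /enum_val_onto[j jE]; exists j.
apply/toric_binomialP/image_mnmP => e; rewrite inc1 /basis_family jE inE.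
by rewrite /inc big1 // => i _; rewrite mnm0E.
Qed.

Lemma MQ_set0 : MQ K M -> set0 \notin bases M.
Proof.
move=> [_ [G [JG quadG]]]; apply/negP => /toric_rank0[j /JG[k [a [g [gG E]]]]].
have : ('X_[U_(j)] - 'X_[0%MM] : {mpoly K[n]})@_0%MM != 0.
  by rewrite mcoeffB !mcoeffX eqxx mnm1_eq0 sub0r oppr_eq0 oner_eq0.
rewrite E raddf_sum /= big1 ?eqxx // => i _.
have [s [t [_ ds dt ->]]] := quadG _ (gG i); rewrite mulrBr mcoeffB.
have zero w : mdeg w = 2%N -> (a i * 'X_[w])@_0%MM = 0.
  move=> dw; apply/eqP; apply: contra_eqT (dw) => /mcoeff_mulX_neq0[w' /esym/eqP].
  by rewrite mnmD_eq0 => /andP[/eqP -> _]; rewrite mdeg0.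
by rewrite !zero // subrr.
Qed.

Section Groebner.
Variables (le : rel 'X_{1..n}).
Hypothesis le_order : monomial_order le.

Let le_refl : reflexive le. Proof. by case: le_order. Qed.

Lemma lead_binomial s t : s != t -> le t s ->
  is_lead_monom le ('X_[s] - 'X_[t] : {mpoly K[n]}) s.
Proof.
move=> st ts; split; first by rewrite mem_msupp_binomial // eqxx.
by move=> m; rewrite mem_msupp_binomial // => /orP[] /eqP ->.
Qed.

Lemma groebner_divisor (G : seq {mpoly K[n]}) s t :
  groebner_basis le (@toric_ideal K T M) G ->
  (forall g, g \in G -> quadratic_binomial g) ->
  s != t -> le t s -> toric_ideal ('X_[s] - 'X_[t] : {mpoly K[n]}) ->
  exists s' t' w,
    [/\ s = (s' + w)%MM, mdeg s' = 2%N, fib b s' t', le t' s' & t' != s'].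
Proof.
move=> [GJ inG] quadG st ts stJ.
have /inG : initial_ideal le (@toric_ideal K T M) 'X_[s].
  apply: ideal_span_gen; exists ('X_[s] - 'X_[t]), s; split=> //.
  exact: lead_binomial.
case/monomial_in_span=> [_ [_ [m [_ _ ->]]]|m [w [[g [m' [gG lead mE]]] sE]]].
  by exists m.
have {}mE : m = m'.
  have := mcoeffX K m m'; rewrite mE mcoeffX eqxx.
  by case: eqP => // _ /eqP; rewrite oner_eq0.
subst m'; have [p [q [pq dp fpq gE]]] := quadratic_toric (quadG _ gG) (GJ _ gG).
case: lead; rewrite gE mem_msupp_binomial // => mpq max.
have lt x : (x == p) || (x == q) -> le x m.
  by move=> x_in; apply: max; rewrite mem_msupp_binomial.
case/orP: mpq => /eqP mE.
  exists p, q, w; split=> //; rewrite -?mE //; first by apply: lt; rewrite eqxx orbT.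
  by rewrite mE eq_sym.
exists q, p, w; split; rewrite -?mE //.
- by rewrite mE; case/fibP: fpq => <-.
- by rewrite mE fib_sym.
- by apply: lt; rewrite eqxx.
- by rewrite mE.
Qed.

End Groebner.

Lemma MQG_set0 : MQG K M -> set0 \notin bases M.
Proof.
move=> [_ [le [G [ord GB quadG]]]]; apply/negP => /toric_rank0[j jJ].
have [||p [q [w [jE dp _ _ _]]]] := groebner_divisor ord GB quadG _ _ jJ.
- by rewrite mnm1_eq0.
- by case: ord => _ _ _ _ [].
by have := mdegD p w; rewrite -jE mdeg1 dp.
Qed.

Lemma MQG_quad_groebner : MQG K M -> quad_groebner b.
Proof.
move=> [_ [le [G [ord GB quadG]]]]; exists le => // u v uv vu nvu.
apply: (groebner_divisor ord GB quadG _ vu); first by rewrite eq_sym.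
by apply/toric_binomialP/image_mnmP; case/fibP: uv.
Qed.

Lemma quad_groebner_MQG :
  set0 \notin bases M -> quad_groebner b -> MQG K M.
Proof.
move=> nz [le ord gb]; split=> //; exists le, quadrics.
split=> //; last exact: quadrics_quadratic.
split=> [|q]; first exact: quadrics_toric.
split; apply: ideal_span_sub => _ [g [m [gJ lead ->]]]; last first.
  by apply: ideal_span_gen; exists g, m; split=> //; exact: quadrics_toric.
case: lead => mg max; have [v [vg vm /image_mnm_fib mv]] := toric_partner gJ mg.
have [p [q' [w [mE dp pq qp nqp]]]] := gb _ _ (mv nz) (max _ vg) vm.
rewrite mE mpolyXD mulrC; apply/ideal_spanM/ideal_span_gen.
rewrite eq_sym in nqp; exists ('X_[p] - 'X_[q']), p; split=> //.
  by apply/quadricsP; exists p, q'.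
exact: lead_binomial.
Qed.

End ToricMonomials.

Lemma MQG_class (K : fieldType) (T : finType) (M : basis_system T) :
  MQG K M <-> pos_class (fun n => @quad_groebner T n) M.
Proof.
split=> [h|[[MM gb] nz]].
  have [MM _] := h; have [_ sub _] := MM.
  by split; [split=> //; exact: MQG_quad_groebner h|exact: MQG_set0 h].
by have [_ sub _] := MM; exact: quad_groebner_MQG.
Qed.

Lemma MQ_class (K : fieldType) (T : finType) (M : basis_system T) :
  MQ K M <-> pos_class (fun n => @quad_connected T n) M.
Proof.
split=> [h|[[MM gb] nz]].
  have [MM _] := h; have [_ sub _] := MM.
  by split; [split=> //; exact: MQ_quad_connected h|exact: MQ_set0 h].
by have [_ sub _] := MM; exact: quad_connected_MQ.
Qed.

Theorem theorem3p3 (K : fieldType) (T : finType) (M1 M2 : basis_system T)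
    (c : T) (hc : ground M1 :&: ground M2 = [set c]) :
  (MQG K M1 -> MQG K M2 ->
    [/\ MQG K (series M1 M2 c),
        MQG K (parallel M1 M2 c)
      & ~~ loop M1 c -> ~~ coloop M1 c -> ~~ loop M2 c -> ~~ coloop M2 c ->
        MQG K (two_sum M1 M2 c)]) /\
  (MQ K M1 -> MQ K M2 ->
    [/\ MQ K (series M1 M2 c),
        MQ K (parallel M1 M2 c)
      & ~~ loop M1 c -> ~~ coloop M1 c -> ~~ loop M2 c -> ~~ coloop M2 c ->
        MQ K (two_sum M1 M2 c)]).
Proof.
have gF := @face_quad_groebner T; have gS := @staircase_quad_groebner T.
have cF := @face_quad_connected T; have cS := @staircase_quad_connected T.
split=> [/MQG_class C1 /MQG_class C2|/MQ_class C1 /MQ_class C2]; split.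
- exact/MQG_class/(pos_class_series gF gS).
- exact/MQG_class/(pos_class_parallel gF gS).
- by move=> *; apply/MQG_class/(pos_class_two_sum gF gS).
- exact/MQ_class/(pos_class_series cF cS).
- exact/MQ_class/(pos_class_parallel cF cS).
- by move=> *; apply/MQ_class/(pos_class_two_sum cF cS).
Qed.
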